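(* Let $\mathbf{Fcompl}$ be the full subcategory of the category $\mathbf{Compl}$ of complexes whose objects are the free complexes $S^{*}$ generated by polygraphs $S$. Then $\mathbf{Fcompl}$ is Cauchy-complete.
   Context: **Cauchy-completeness.** A category is Cauchy-complete if all its idempotents split: for each object $C$ and each endomorphism $h:C\to C$ with $h\circ h=h$, there are an object $D$ and morphisms $r:C\to D$, $u:D\to C$ with $u\circ r=h$ and $r\circ u=\mathrm{id}_D$. **Globular sets and complexes.** A globular set $X$ consists of sets $X_n$ ($n\ge 0$) of $n$-cells and maps $\sigma_n,\tau_n:X_{n+1}\to X_n$ (source, target) with $\sigma_n\sigma_{n+1}=\sigma_n\tau_{n+1}$ and $\tau_n\sigma_{n+1}=\tau_n\tau_{n+1}$. For $i<n$ put $\sigma_{i,n}=\sigma_i\circ\cdots\circ\sigma_{n-1}$ and $\tau_{i,n}=\tau_i\circ\cdots\circ\tau_{n-1}$. Two $n$-cells are parallel if they have the same source and the same target; any two $0$-cells are parallel. A complex is a strict $\infty$-category: a globular set $C$ with compositions $u\ast_i v\in C_n$ for $i<n$ and $u,v\in C_n$ with $\tau_{i,n}u=\sigma_{i,n}v$, and units $1_{n+1}:C_n\to C_{n+1}$, with the usual sources and targets, satisfying associativity, left and right unit laws, the exchange law $(x\ast_i y)\ast_j(z\ast_i t)=(x\ast_j z)\ast_i(y\ast_j t)$ for $i<j$, and $1_{n+1}(x\ast_i y)=1_{n+1}(x)\ast_i 1_{n+1}(y)$. Morphisms of complexes are morphisms of globular sets preserving compositions and units; $\mathbf{Compl}$ is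 the resulting category. An $n$-category is the analogous structure with cells only in dimensions $\le n$. **Polygraphs and free complexes.** Given an $n$-category $C_0\Leftarrow\cdots\Leftarrow C_n$ and a set $S_{n+1}$ with maps $\sigma_n,\tau_n:S_{n+1}\to C_n$ satisfying the boundary conditions ($\sigma_n(\xi)$ and $\tau_n(\xi)$ are parallel for each $\xi\in S_{n+1}$), one forms the free $(n+1)$-category $C_0\Leftarrow\cdots\Leftarrow C_n\Leftarrow S_{n+1}^{*}$: it coincides with the given $n$-category up to dimension $n$, and $S_{n+1}^{*}$ consists of formal composites of elements of $S_{n+1}$ and identities on cells of $C_n$, modulo the axioms of $(n+1)$-categories. A $0$-polygraph is a set $S_0$, with $S_0^{*}=S_0$. Inductively, an $(n+1)$-polygraph is an $n$-polygraph generating a free $n$-category $S_0^{*}\Leftarrow\cdots\Leftarrow S_n^{*}$, together with a set $S_{n+1}$ and maps $\sigma_n,\tau_n:S_{n+1}\to S_n^{*}$ satisfying the boundary conditions; it generates the free $(n+1)$-category $S_0^{*}\Leftarrow\cdots\Leftarrow S_n^{*}\Leftarrow S_{n+1}^{*}$. A polygraph $S$ is an infinite sequence $S_0^{*}\Leftarrow S_1,\ S_1^{*}\Leftarrow S_2,\ldots$ whose first $n$ items define an $n$-polygraph for each $n$. The free complex it generates is $S^{*}:S_0^{*}\Leftarrow S_1^{*}\Leftarrow S_2^{*}\Leftarrow\cdots$. Morphisms in $\mathbf{Fcompl}$ are all morphisms of complexes between free complexes; they need not send generators to generators. *)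

(* Defs.v *)
From HB Require Import structures.
From mathcomp Require Import all_boot.
From mathcomp Require Import boolp.

Set Implicit Arguments.
Unset Strict Implicit.
Unset Printing Implicit Defensive.

Record category := Category {
  obj :> Type;
  hom : obj -> obj -> Type;
  idm : forall A, hom A A;
  mcomp : forall A B C, hom B C -> hom A B -> hom A C;
  mcompA : forall A B C D (h : hom C D) (g : hom B C) (f : hom A B),
    mcomp h (mcomp g f) = mcomp (mcomp h g) f;
  mcomp1m : forall A B (f : hom A B), mcomp (idm B) f = f;
  mcompm1 : forall A B (f : hom A B), mcomp f (idm A) = f
}.
Arguments hom {_} _ _.
Arguments idm {_} _.
Arguments mcomp {_ _ _ _} _ _.

Definition full_subcategory (K : category) (P : K -> Prop) : category :=
  @Category {A : K | P A} (fun A B => hom (sval A) (sval B))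
    (fun A => idm (sval A)) (fun A B C g f => mcomp g f)
    (fun A B C D h g f => mcompA h g f)
    (fun A B f => mcomp1m f) (fun A B f => mcompm1 f).

Definition Cauchy_complete (K : category) : Prop :=
  forall (C : K) (h : hom C C), mcomp h h = h ->
  exists (D : K) (r : hom C D) (u : hom D C),
    mcomp u r = h /\ mcomp r u = idm D.

Record globular := Globular {
  cell :> nat -> Type;
  src : forall n, cell n.+1 -> cell n;
  tgt : forall n, cell n.+1 -> cell n;
  src_src : forall n (x : cell n.+2), src (src x) = src (tgt x);
  tgt_src : forall n (x : cell n.+2), tgt (src x) = tgt (tgt x)
}.
Arguments src {_ n} _.
Arguments tgt {_ n} _.

Lemma leq_neq_lt k n : k <> n -> k <= n -> k < n.
Proof. by rewrite ltn_neqAle => /eqP -> ->. Qed.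

Section Iterates.
Variables (X : nat -> Type) (i : nat).

Lemma leq_neq_false : i <> 0 -> i <= 0 -> False.
Proof. by move=> ne; rewrite leqn0 => /eqP. Qed.

Lemma leq_neqS n : i <> n.+1 -> i <= n.+1 -> i <= n.
Proof. by move=> /eqP ne; rewrite leq_eqVlt (negPf ne). Qed.

(* The iterate X n -> X i of maps X m.+1 -> X m; see [down_refl], [downS]. *)
Fixpoint down (d : forall n, X n.+1 -> X n) n : i <= n -> X n -> X i :=
  match i =P n with
  | ReflectT e => fun _ x => ecast k (X k) (esym e) x
  | ReflectF ne =>
    match n return i <> n -> i <= n -> X n -> X i with
    | 0 => fun ne le _ => False_rect _ (leq_neq_false ne le)
    | m.+1 => fun ne le x => down d (leq_neqS ne le) (d m x)
    end ne
  end.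

Lemma down_refl d (le : i <= i) x : down d le x = x.
Proof.
suff E n (e : i = n) (len : i <= n) (y : X n) :
  down d len y = ecast k (X k) (esym e) y by rewrite (E i erefl).
by case: n e len y => [|n] e len y /=; case: eqP => // e';
  rewrite (eq_irrelevance e e').
Qed.

Lemma downS d n (le : i <= n) (leS : i <= n.+1) x :
  down d leS x = down d le (d n x).
Proof.
rewrite /=; case: eqP => [e|ne]; last by rewrite (bool_irrelevance (leq_neqS _ _) le).
by exfalso; move: le => {x leS}; rewrite e ltnn.
Qed.

(* [None] stands for the absence of a bound on dimensions. *)
Definition within (N : option nat) (n : nat) : bool :=
  if N is Some m then n <= m else true.

Lemma withinW N n : within N n.+1 -> within N n.
Proof. by case: N => //= m /ltnW. Qed.

Variable N : option nat.

Fixpoint up (s : forall n, within N n.+1 -> X n -> X n.+1) n :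
    i <= n -> within N n -> X i -> X n :=
  match i =P n with
  | ReflectT e => fun _ _ x => ecast k (X k) e x
  | ReflectF ne =>
    match n return i <> n -> i <= n -> within N n -> X i -> X n with
    | 0 => fun ne le _ _ => False_rect _ (leq_neq_false ne le)
    | m.+1 => fun ne le b x => s m b (up s (leq_neqS ne le) (withinW b) x)
    end ne
  end.

Lemma up_refl s (le : i <= i) b x : up s le b x = x.
Proof.
suff E n (e : i = n) (len : i <= n) b' : up s len b' x = ecast k (X k) e x.
  by rewrite (E i erefl).
by case: n e len b' => [|n] e len b' /=; case: eqP => // e';
  rewrite (eq_irrelevance e e').
Qed.

Lemma upS s n (le : i <= n) (leS : i <= n.+1) b bS x :
  up s leS bS x = s n bS (up s le b x).
Proof.
rewrite /=; case: eqP => [e|ne]; first by exfalso; move: le => {x leS}; rewrite e ltnn.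
by rewrite (bool_irrelevance (leq_neqS _ _) le) (bool_irrelevance (withinW _) b).
Qed.

End Iterates.

Section GlobularTheory.
Variable X : globular.

Definition src_to i n (le : i <= n) : X n -> X i := down (@src X) le.
Definition tgt_to i n (le : i <= n) : X n -> X i := down (@tgt X) le.

Definition parallel n : X n -> X n -> Prop :=
  match n with
  | 0 => fun _ _ => True
  | m.+1 => fun x y => src x = src y /\ tgt x = tgt y
  end.

Definition composable i n (x y : X n) : Prop :=
  exists lt : i < n, tgt_to (ltnW lt) x = src_to (ltnW lt) y.

Lemma composable_lt i n (x y : X n) : composable i x y -> i < n.
Proof. by case. Qed.

Lemma composable_top n (x y : X n.+1) : composable n x y <-> tgt x = src y.
Proof.
rewrite /composable /tgt_to /src_to; split=> [[lt]|E].
  by rewrite !(downS _ (leqnn n)) !down_refl.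
by exists (ltnSn n); rewrite !(downS _ (leqnn n)) !down_refl.
Qed.

Lemma composableS i n (x y : X n.+1) :
  i < n -> composable i x y <-> composable i (tgt x) (src y).
Proof.
move=> lt; rewrite /composable /tgt_to /src_to; split=> -[lt'].
  by rewrite !(downS _ (ltnW lt)) => E; exists lt.
by move=> E; exists (ltnW lt); rewrite !(downS _ (ltnW lt')).
Qed.

Lemma src_to_par i n (lt : i < n) (x y : X n) :
  parallel x y -> src_to (ltnW lt) x = src_to (ltnW lt) y.
Proof.
case: n lt x y => // n lt x y [Es _].
by rewrite /src_to !(downS _ (lt : i <= n)) Es.
Qed.

Lemma tgt_to_par i n (lt : i < n) (x y : X n) :
  parallel x y -> tgt_to (ltnW lt) x = tgt_to (ltnW lt) y.
Proof.
case: n lt x y => // n lt x y [_ Et].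
by rewrite /tgt_to !(downS _ (lt : i <= n)) Et.
Qed.

Lemma parallel_sym n (x y : X n) : parallel x y -> parallel y x.
Proof. by case: n x y => //= n x y [-> ->]. Qed.

Lemma parallel_trans n (x y z : X n) :
  parallel x y -> parallel y z -> parallel x z.
Proof. by case: n x y z => //= n x y z [-> ->]. Qed.

Lemma parallel_refl n (x : X n) : parallel x x.
Proof. by case: n x. Qed.

Lemma parallel_bd n (x : X n.+1) : parallel (src x) (tgt x).
Proof. by case: n x => //= n x; rewrite src_src tgt_src. Qed.

Lemma composable_par i n (x x' y y' : X n) :
  parallel x x' -> parallel y y' -> composable i x y -> composable i x' y'.
Proof.
move=> px py [lt E]; exists lt.
by rewrite -(tgt_to_par lt px) -(src_to_par lt py).
Qed.

Lemma composable_src i n (x y : X n.+1) :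
  i < n -> composable i x y -> composable i (src x) (src y).
Proof.
move=> lt /(composableS _ _ lt).
apply: composable_par; last exact: parallel_refl.
exact/parallel_sym/parallel_bd.
Qed.

Lemma composable_tgt i n (x y : X n.+1) :
  i < n -> composable i x y -> composable i (tgt x) (tgt y).
Proof.
move=> lt /(composableS _ _ lt).
by apply: composable_par; [exact: parallel_refl | exact: parallel_bd].
Qed.

End GlobularTheory.

Section GlobularMaps.
Variables (X Y : globular) (f : forall n, X n -> Y n).
Hypothesis f_src : forall n (x : X n.+1), f (src x) = src (f x).
Hypothesis f_tgt : forall n (x : X n.+1), f (tgt x) = tgt (f x).

Lemma map_src_to i n (le : i <= n) (x : X n) : f (src_to le x) = src_to le (f x).
Proof.
rewrite /src_to; elim: n le x => [|n IH] le x.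
  have /eqP e : i == 0 by rewrite -leqn0.
  by subst i; rewrite !down_refl.
case: (eqVneq i n.+1) => [e|ne]; first by subst i; rewrite !down_refl.
have le' : i <= n by apply: leq_neqS le; apply/eqP.
by rewrite !(downS _ le') IH f_src.
Qed.

Lemma map_tgt_to i n (le : i <= n) (x : X n) : f (tgt_to le x) = tgt_to le (f x).
Proof.
rewrite /tgt_to; elim: n le x => [|n IH] le x.
  have /eqP e : i == 0 by rewrite -leqn0.
  by subst i; rewrite !down_refl.
case: (eqVneq i n.+1) => [e|ne]; first by subst i; rewrite !down_refl.
have le' : i <= n by apply: leq_neqS le; apply/eqP.
by rewrite !(downS _ le') IH f_tgt.
Qed.

Lemma map_composable i n (x y : X n) :
  composable i x y -> composable i (f x) (f y).
Proof. by case=> lt E; exists lt; rewrite -map_tgt_to -map_src_to E. Qed.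

Lemma map_composableV i n (x y : X n) : (forall k, injective (@f k)) ->
  composable i (f x) (f y) -> composable i x y.
Proof. by move=> inj [lt]; rewrite -map_tgt_to -map_src_to => /inj; exists lt. Qed.

End GlobularMaps.

(* The data of an n-category (N = Some n) or of a strict oo-category (N = None).
   An n-category has no cells above dimension n, so that the bound only needs
   to be mentioned for units. *)
Record precat (N : option nat) := Precat {
  pglob :> globular;
  cell_dim : forall n, pglob n -> within N n;
  cunit : forall n, within N n.+1 -> pglob n -> pglob n.+1;
  comp : forall i n (x y : pglob n), composable i x y -> pglob n
}.
Arguments cell_dim {_ _ n} _.
Arguments cunit {_ _ n} _ _.
Arguments comp {_ _ i n x y} _.

Definition unit_to N (C : precat N) i n (le : i <= n) (b : within N n) :
  C i -> C n := up (@cunit N C) le b.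

(* Composition is defined on composable pairs only.  An equation between
   composites is stated for all proofs that its two sides are defined; these
   proofs exist as soon as the boundaries match, by [src_comp_top], ...,
   [tgt_comp].  Composability along [i] of n-cells entails i < n. *)
Record is_cat (N : option nat) (C : precat N) : Prop := IsCat {
  src_unit : forall n b (x : C n), src (cunit b x) = x;
  tgt_unit : forall n b (x : C n), tgt (cunit b x) = x;
  src_comp_top : forall n (x y : C n.+1) (h : composable n x y),
    src (comp h) = src x;
  tgt_comp_top : forall n (x y : C n.+1) (h : composable n x y),
    tgt (comp h) = tgt y;
  src_comp : forall i n (x y : C n.+1) (h : composable i x y)
    (h' : composable i (src x) (src y)), src (comp h) = comp h';
  tgt_comp : forall i n (x y : C n.+1) (h : composable i x y)
    (h' : composable i (tgt x) (tgt y)), tgt (comp h) = comp h';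
  compA : forall i n (x y z : C n)
    (hxy : composable i x y) (hxy_z : composable i (comp hxy) z)
    (hyz : composable i y z) (hx_yz : composable i x (comp hyz)),
    comp hxy_z = comp hx_yz;
  comp1x : forall i n (le : i <= n) (x : C n)
    (h : composable i (unit_to le (cell_dim x) (src_to le x)) x), comp h = x;
  compx1 : forall i n (le : i <= n) (x : C n)
    (h : composable i x (unit_to le (cell_dim x) (tgt_to le x))), comp h = x;
  exchange : forall i j n (x y z t : C n), i < j ->
    forall (hxy : composable i x y) (hzt : composable i z t)
      (hxz : composable j x z) (hyt : composable j y t)
      (hj : composable j (comp hxy) (comp hzt))
      (hi : composable i (comp hxz) (comp hyt)),
    comp hj = comp hi;
  unit_comp : forall i n b (x y : C n) (h : composable i x y)
    (h' : composable i (cunit b x) (cunit b y)), cunit b (comp h) = comp h'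
}.

Record cat (N : option nat) := Cat {
  pcat :> precat N;
  catP : is_cat pcat
}.

Definition ncat (n : nat) := cat (Some n).
Definition complex := cat None.

Record cat_hom (N : option nat) (C D : cat N) := CatHom {
  cmap :> forall n, C n -> D n;
  cmap_src : forall n (x : C n.+1), cmap (src x) = src (cmap x);
  cmap_tgt : forall n (x : C n.+1), cmap (tgt x) = tgt (cmap x);
  cmap_unit : forall n b (x : C n), cmap (cunit b x) = cunit b (cmap x);
  cmap_comp : forall i n (x y : C n) (h : composable i x y)
    (h' : composable i (cmap x) (cmap y)), cmap (comp h) = comp h'
}.

Section CatHoms.
Variable N : option nat.

Lemma cat_hom_eq (C D : cat N) (f g : cat_hom C D) :
  (forall n (x : C n), f n x = g n x) -> f = g.
Proof.
case: f g => [f f1 f2 f3 f4] [g g1 g2 g3 g4] /= E.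
have {}E : f = g by apply: functional_extensionality_dep => n; apply/funext.
by subst g; congr CatHom.
Qed.

Definition cat_id (C : cat N) : cat_hom C C.
Proof.
exists (fun n x => x) => // i n x y h h'.
by rewrite (Prop_irrelevance h h').
Defined.

Definition cat_comp (C D E : cat N) (g : cat_hom D E) (f : cat_hom C D) :
  cat_hom C E.
Proof.
exists (fun n x => g n (f n x)) => [n x|n x|n b x|i n x y h h'].
- by rewrite !cmap_src.
- by rewrite !cmap_tgt.
- by rewrite !cmap_unit.
- have h2 := map_composable (cmap_src f) (cmap_tgt f) h.
  by rewrite (cmap_comp h h2) (cmap_comp h2 h').
Defined.

End CatHoms.

Definition Compl : category.
Proof.
by refine (@Category complex (@cat_hom None) (@cat_id None) (@cat_comp None)
  _ _ _) => *; apply: cat_hom_eq.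
Defined.

Section IdentityOnBoundary.
Variables (N : option nat) (C : precat N).

Lemma unit_to_refl i (le : i <= i) b (x : C i) : unit_to le b x = x.
Proof. exact: up_refl. Qed.

Lemma unit_toS i n (le : i <= n) (leS : i <= n.+1) b bS (x : C i) :
  unit_to leS bS x = cunit bS (unit_to le b x).
Proof. exact: upS. Qed.

Lemma src_to_refl i (le : i <= i) (x : C i) : src_to le x = x.
Proof. exact: down_refl. Qed.

Lemma tgt_to_refl i (le : i <= i) (x : C i) : tgt_to le x = x.
Proof. exact: down_refl. Qed.

Lemma src_toS i n (le : i <= n) (leS : i <= n.+1) (x : C n.+1) :
  src_to leS x = src_to le (src x).
Proof. exact: downS. Qed.

Lemma tgt_toS i n (le : i <= n) (leS : i <= n.+1) (x : C n.+1) :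
  tgt_to leS x = tgt_to le (tgt x).
Proof. exact: downS. Qed.

Lemma comp_eq i n (x x' y y' : C n) (h : composable i x y)
  (h' : composable i x' y') : x = x' -> y = y' -> comp h = comp h'.
Proof. by move=> ex ey; subst x' y'; rewrite (Prop_irrelevance h h'). Qed.

End IdentityOnBoundary.

Lemma map_unit_to N M (C : precat N) (D : precat M) (f : forall n, C n -> D n)
    (f_unit : forall n b b' (x : C n), f _ (cunit b x) = cunit b' (f _ x))
    i n (le : i <= n) b b' (x : C i) :
  f _ (unit_to le b x) = unit_to le b' (f _ x).
Proof.
elim: n le b b' => [|n IH] le b b'.
  have /eqP e : i == 0 by rewrite -leqn0.
  by subst i; rewrite !unit_to_refl.
case: (eqVneq i n.+1) => [e|ne]; first by subst i; rewrite !unit_to_refl.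
have le' : i <= n by apply: leq_neqS le; apply/eqP.
rewrite (unit_toS le' _ (withinW b)) (unit_toS le' _ (withinW b')).
by rewrite (f_unit _ _ b') (IH _ _ (withinW b')).
Qed.

Lemma comp_parallel N (C : cat N) i n (a b a' b' : C n)
    (h : composable i a a') (h' : composable i b b') :
  parallel a b -> parallel a' b' -> parallel (comp h) (comp h').
Proof.
have P := catP C; case: n a b a' b' h h' => // n a b a' b' h h' [es et] [es' et'].
have := composable_lt h; rewrite ltnS leq_eqVlt => /orP[/eqP e|lt]; split.
- by subst i; rewrite !(src_comp_top P).
- by subst i; rewrite !(tgt_comp_top P).
- rewrite (src_comp P h (composable_src lt h)).
  by rewrite (src_comp P h' (composable_src lt h')); apply: comp_eq.
- rewrite (tgt_comp P h (composable_tgt lt h)).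
  by rewrite (tgt_comp P h' (composable_tgt lt h')); apply: comp_eq.
Qed.

Section Discrete.
Variable S : Type.

Definition discrete_cell (n : nat) : Type := if n is 0 then S else void.

Definition discrete_glob : globular :=
  @Globular discrete_cell (fun n => @of_void _) (fun n => @of_void _)
    (fun n x => match x with end) (fun n x => match x with end).

Lemma discrete_composable i n (x y : discrete_glob n) : ~ composable i x y.
Proof. by case: n x y => [|n] x y; [case|case: x]. Qed.

Lemma discrete_dim n : discrete_glob n -> within (Some 0) n.
Proof. by case: n => // n []. Qed.

Definition discrete_precat : precat (Some 0) :=
  @Precat (Some 0) discrete_glob discrete_dim
    (fun n (b : n.+1 <= 0) _ => False_rect _ (notF b))
    (fun i n x y h => False_rect _ (discrete_composable h)).

Lemma discrete_is_cat : is_cat discrete_precat.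
Proof. by split=> // *; exfalso; apply: discrete_composable; eassumption. Qed.

Definition discrete : ncat 0 := Cat discrete_is_cat.

End Discrete.

Record generators (n : nat) (C : ncat n) := Generators {
  gen :> Type;
  gsrc : gen -> C n;
  gtgt : gen -> C n;
  gpar : forall x, parallel (gsrc x) (gtgt x)
}.
Arguments gsrc {_ _ _} _.
Arguments gtgt {_ _ _} _.

Local Open Scope quotient_scope.

Section FreeExtension.
Variables (n : nat) (C : ncat n) (G : generators C).

(* [comp_boundary i a b a' b' c d]: the composite along dimension [i] of an
   (n+1)-cell [a -> b] with an (n+1)-cell [a' -> b'] makes sense and is an
   (n+1)-cell [c -> d]. *)
Inductive comp_boundary (i : nat) (a b a' b' : C n) : C n -> C n -> Prop :=
| comp_boundary_top : i = n -> b = a' -> comp_boundary i a b a' b' a b'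
| comp_boundary_low (h : composable i a a') (h' : composable i b b') :
    comp_boundary i a b a' b' (comp h) (comp h').

(* Formal composites, indexed by source and target. *)
Inductive term : C n -> C n -> Type :=
| tgen (x : G) : term (gsrc x) (gtgt x)
| tunit (a : C n) : term a a
| tcomp (i : nat) (a b a' b' c d : C n) :
    comp_boundary i a b a' b' c d -> term a b -> term a' b' -> term c d.

(* The congruence generated by the axioms of (n+1)-categories.  It relates terms
   over possibly different pairs of n-cells, since the two sides of an axiom
   have boundaries that are only provably equal ([cong_bd]). *)
Inductive cong : forall a b a' b' : C n, term a b -> term a' b' -> Prop :=
| cong_refl a b (u : term a b) : cong u u
| cong_sym a b a' b' (u : term a b) (v : term a' b') : cong u v -> cong v u
| cong_trans a b a' b' a'' b''
    (u : term a b) (v : term a' b') (w : term a'' b'') :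
    cong u v -> cong v w -> cong u w
| cong_comp i a b a' b' c d a1 b1 a1' b1' c1 d1
    (p : comp_boundary i a b a' b' c d) (u : term a b) (v : term a' b')
    (q : comp_boundary i a1 b1 a1' b1' c1 d1)
    (u1 : term a1 b1) (v1 : term a1' b1') :
    cong u u1 -> cong v v1 -> cong (tcomp p u v) (tcomp q u1 v1)
| cong_compA i a b a' b' a'' b'' c d c' d' e f e' f'
    (u : term a b) (v : term a' b') (w : term a'' b'')
    (uv : comp_boundary i a b a' b' c d)
    (uv_w : comp_boundary i c d a'' b'' e f)
    (vw : comp_boundary i a' b' a'' b'' c' d')
    (u_vw : comp_boundary i a b c' d' e' f') :
    cong (tcomp uv_w (tcomp uv u v) w) (tcomp u_vw u (tcomp vw v w))
| cong_comp1x i (le : i <= n) a b c d (u : term a b)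
    (a1 := unit_to le (cell_dim a) (src_to le a))
    (p : comp_boundary i a1 a1 a b c d) :
    cong (tcomp p (tunit a1) u) u
| cong_compx1 i (le : i <= n) a b c d (u : term a b)
    (b1 := unit_to le (cell_dim b) (tgt_to le b))
    (p : comp_boundary i a b b1 b1 c d) :
    cong (tcomp p u (tunit b1)) u
| cong_exchange i j a1 b1 a2 b2 a3 b3 a4 b4 c12 d12 c34 d34 c13 d13 c24 d24
    c d c' d'
    (x : term a1 b1) (y : term a2 b2) (z : term a3 b3) (t : term a4 b4)
    (xy : comp_boundary i a1 b1 a2 b2 c12 d12)
    (zt : comp_boundary i a3 b3 a4 b4 c34 d34)
    (xz : comp_boundary j a1 b1 a3 b3 c13 d13)
    (yt : comp_boundary j a2 b2 a4 b4 c24 d24)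
    (xy_zt : comp_boundary j c12 d12 c34 d34 c d)
    (xz_yt : comp_boundary i c13 d13 c24 d24 c' d') :
    i < j ->
    cong (tcomp xy_zt (tcomp xy x y) (tcomp zt z t))
         (tcomp xz_yt (tcomp xz x z) (tcomp yt y t))
| cong_unit_comp i a b (h : composable i a b) c d
    (p : comp_boundary i a a b b c d) :
    cong (tunit (comp h)) (tcomp p (tunit a) (tunit b)).

Record formal := Formal {
  fsrc : C n;
  ftgt : C n;
  fterm : term fsrc ftgt
}.

HB.instance Definition _ := gen_eqMixin formal.
HB.instance Definition _ := gen_choiceMixin formal.

Definition fcong (u v : formal) : bool := `[< cong (fterm u) (fterm v) >].

Lemma fcong_refl : reflexive fcong.
Proof. by move=> u; apply/asboolP; apply: cong_refl. Qed.

Lemma fcong_sym : symmetric fcong.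
Proof. by move=> u v; apply/asboolP/asboolP; apply: cong_sym. Qed.

Lemma fcong_trans : transitive fcong.
Proof.
move=> v u w /asboolP uv /asboolP vw; apply/asboolP.
exact: cong_trans uv vw.
Qed.

Canonical fcong_equiv := EquivRel fcong fcong_refl fcong_sym fcong_trans.

Definition top_cell : Type := {eq_quot fcong}.
Definition class (u : formal) : top_cell := \pi_({eq_quot fcong}) u.

Definition rep (q : top_cell) : formal := repr (q : {eq_quot fcong}).

Lemma repK q : class (rep q) = q.
Proof. exact: reprK. Qed.

Lemma classP (u v : formal) : class u = class v <-> cong (fterm u) (fterm v).
Proof.
rewrite /class; split=> [/eqmodP /asboolP //|uv].
by apply/eqmodP/asboolP.
Qed.

Lemma comp_boundaryE i (a b a' b' c d : C n) : comp_boundary i a b a' b' c d ->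
  [/\ i = n, b = a', c = a & d = b'] \/
  exists (h : composable i a a') (h' : composable i b b'),
    c = comp h /\ d = comp h'.
Proof. by case=> [? ?|h h']; [left|right; exists h, h']. Qed.

Lemma comp_boundary_topE (a b a' b' c d : C n) :
  comp_boundary n a b a' b' c d -> [/\ b = a', c = a & d = b'].
Proof.
by case/comp_boundaryE=> [[]|[h _]] //; have := composable_lt h; rewrite ltnn.
Qed.

Lemma comp_boundary_lowE i (a b a' b' c d : C n) : i < n ->
  comp_boundary i a b a' b' c d ->
  exists (h : composable i a a') (h' : composable i b b'),
    c = comp h /\ d = comp h'.
Proof. by move=> lt /comp_boundaryE[[e]|//]; move: lt; rewrite e ltnn. Qed.

Lemma comp_boundary_le i (a b a' b' c d : C n) :
  comp_boundary i a b a' b' c d -> i <= n.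
Proof. by case/comp_boundaryE=> [[->]|[h _]] //; apply/ltnW/composable_lt/h. Qed.

Lemma term_parallel a b : term a b -> parallel a b.
Proof.
elim=> {a b} [x|x|i a b a' b' c d p _ ab _ a'b'].
- exact: gpar.
- exact: parallel_refl.
case/comp_boundaryE: p => [[_ e -> ->]|[h [h' [-> ->]]]].
  by apply: parallel_trans a'b'; rewrite -e.
exact: comp_parallel.
Qed.

Lemma cong_bd a b a' b' (u : term a b) (v : term a' b') :
  cong u v -> a = a' /\ b = b'.
Proof.
have P := catP C.
elim=> {a b a' b' u v} //.
- by move=> a b a' b' u v _ [-> ->].
- by move=> a b a' b' a'' b'' u v w _ [-> ->] _ [-> ->].
- move=> i a b a' b' c d a1 b1 a1' b1' c1 d1 p u v q u1 v1 _ [e1 e2] _ [e3 e4].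
  subst; have := comp_boundary_le p; rewrite leq_eqVlt => /orP[/eqP ei|lt].
    subst i; case/comp_boundary_topE: p => _ -> ->.
    by case/comp_boundary_topE: q => _ -> ->.
  case/(comp_boundary_lowE lt): p => [h [h' [-> ->]]].
  case/(comp_boundary_lowE lt): q => [k [k' [-> ->]]].
  by split; apply: comp_eq.
- move=> i a b a' b' a'' b'' c d c' d' e f e' f' u v w uv uv_w vw u_vw.
  have := comp_boundary_le uv; rewrite leq_eqVlt => /orP[/eqP ei|lt].
    subst i; case/comp_boundary_topE: uv uv_w => _ -> ->.
    case/comp_boundary_topE=> _ -> ->; case/comp_boundary_topE: u_vw => _ -> ->.
    by case/comp_boundary_topE: vw.
  case/(comp_boundary_lowE lt): uv uv_w => [h1 [h1' [-> ->]]].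
  case/(comp_boundary_lowE lt)=> [h2 [h2' [-> ->]]].
  case/(comp_boundary_lowE lt): vw u_vw => [h3 [h3' [-> ->]]].
  case/(comp_boundary_lowE lt)=> [h4 [h4' [-> ->]]].
  by split; apply: compA.
- move=> i le a b c d u a1 p.
  have par := term_parallel u.
  have := comp_boundary_le p; rewrite leq_eqVlt => /orP[/eqP ei|lt].
    subst i; case/comp_boundary_topE: p => _ -> ->.
    by rewrite /a1 unit_to_refl src_to_refl.
  case/(comp_boundary_lowE lt): p => [h [h' [-> ->]]]; split; first exact: comp1x.
  have e : a1 = unit_to le (cell_dim b) (src_to le b).
    rewrite /a1 (bool_irrelevance le (ltnW lt)) (src_to_par lt par).
    by congr unit_to; apply: bool_irrelevance.
  by move: h'; rewrite e => h'; apply: comp1x.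
- move=> i le a b c d u b1 p.
  have par := term_parallel u.
  have := comp_boundary_le p; rewrite leq_eqVlt => /orP[/eqP ei|lt].
    subst i; case/comp_boundary_topE: p => _ -> ->.
    by rewrite /b1 unit_to_refl tgt_to_refl.
  case/(comp_boundary_lowE lt): p => [h [h' [-> ->]]]; split; last exact: compx1.
  have e : b1 = unit_to le (cell_dim a) (tgt_to le a).
    rewrite /b1 (bool_irrelevance le (ltnW lt)) -(tgt_to_par lt par).
    by congr unit_to; apply: bool_irrelevance.
  by move: h; rewrite e => h; apply: compx1.
- move=> i j a1 b1 a2 b2 a3 b3 a4 b4 c12 d12 c34 d34 c13 d13 c24 d24 c d c' d'.
  move=> x y z t xy zt xz yt xy_zt xz_yt lt.
  have lej := comp_boundary_le xz; have lti := leq_trans lt lej.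
  case/(comp_boundary_lowE lti): xy xy_zt => [h1 [h1' [-> ->]]].
  case/(comp_boundary_lowE lti): zt => [h2 [h2' [-> ->]]].
  move: lej; rewrite leq_eqVlt => /orP[/eqP ej|ltj].
    subst j; case/comp_boundary_topE=> _ -> ->.
    case/comp_boundary_topE: xz xz_yt => _ -> ->.
    case/comp_boundary_topE: yt => _ -> ->.
    by case/(comp_boundary_lowE lti)=> [h3 [h3' [-> ->]]]; split; apply: comp_eq.
  case/(comp_boundary_lowE ltj)=> [h3 [h3' [-> ->]]].
  case/(comp_boundary_lowE ltj): xz xz_yt => [h4 [h4' [-> ->]]].
  case/(comp_boundary_lowE ltj): yt => [h5 [h5' [-> ->]]].
  case/(comp_boundary_lowE lti)=> [h6 [h6' [-> ->]]].
  by split; apply: exchange.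
- move=> i a b h c d p.
  case/(comp_boundary_lowE (composable_lt h)): p => [h3 [h3' [-> ->]]].
  by split; apply: comp_eq.
Qed.

Definition top_src (q : top_cell) : C n := fsrc (rep q).
Definition top_tgt (q : top_cell) : C n := ftgt (rep q).

Lemma rep_class (u : formal) : cong (fterm (rep (class u))) (fterm u).
Proof. by apply/classP; rewrite repK. Qed.

Lemma top_src_class u : top_src (class u) = fsrc u.
Proof. by have [] := cong_bd (rep_class u). Qed.

Lemma top_tgt_class u : top_tgt (class u) = ftgt u.
Proof. by have [] := cong_bd (rep_class u). Qed.

Lemma top_parallel q : parallel (top_src q) (top_tgt q).
Proof. exact: term_parallel (fterm (rep q)). Qed.

(* Composability of (n+1)-cells along dimension [i]. *)
Definition top_composable (i : nat) (q r : top_cell) : Prop :=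
  (i = n /\ top_tgt q = top_src r) \/ composable i (top_tgt q) (top_src r).

Lemma top_composable_src i q r : i <> n -> top_composable i q r ->
  composable i (top_src q) (top_src r).
Proof.
move=> ne [[]//|]; apply: composable_par; last exact: parallel_refl.
exact/parallel_sym/top_parallel.
Qed.

Lemma top_composable_tgt i q r : i <> n -> top_composable i q r ->
  composable i (top_tgt q) (top_tgt r).
Proof.
move=> ne [[]//|].
by apply: composable_par; [exact: parallel_refl | exact: top_parallel].
Qed.

Lemma top_composable_top q r : top_composable n q r -> top_tgt q = top_src r.
Proof. by case=> [[]//|/composable_lt]; rewrite ltnn. Qed.

Definition top_comp (i : nat) (q r : top_cell) (h : top_composable i q r) :
  top_cell :=
  match i =P n with
  | ReflectT e =>
      class (Formal (tcomp
        (comp_boundary_top _ _ e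
           (top_composable_top (ecast k (top_composable k q r) e h)))
        (fterm (rep q)) (fterm (rep r))))
  | ReflectF ne =>
      class (Formal (tcomp
        (comp_boundary_low (top_composable_src ne h) (top_composable_tgt ne h))
        (fterm (rep q)) (fterm (rep r))))
  end.

Lemma top_compE i q r (h : top_composable i q r) a b a' b' c d
    (p : comp_boundary i a b a' b' c d) (u : term a b) (v : term a' b') :
  q = class (Formal u) -> r = class (Formal v) ->
  top_comp h = class (Formal (tcomp p u v)).
Proof.
move=> eq er; rewrite /top_comp.
have qu : cong (fterm (rep q)) u by rewrite eq; apply: (rep_class (Formal u)).
have rv : cong (fterm (rep r)) v by rewrite er; apply: (rep_class (Formal v)).
by case: eqP => [e|ne]; apply/classP; apply: cong_comp.
Qed.

Lemma top_compX i q r (h : top_composable i q r) a b a' b'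
    (u : term a b) (v : term a' b') :
  q = class (Formal u) -> r = class (Formal v) ->
  exists c d (p : comp_boundary i a b a' b' c d),
    top_comp h = class (Formal (tcomp p u v)).
Proof.
move=> eq er; suff [c [d p]] : exists c d, comp_boundary i a b a' b' c d.
  by exists c, d, p; apply: top_compE.
have pu := term_parallel u; have pv := term_parallel v.
have qb : top_tgt q = b by rewrite eq top_tgt_class.
have ra : top_src r = a' by rewrite er top_src_class.
move: h; rewrite /top_composable qb ra => -[[e eb]|h].
  by exists a, b'; apply: comp_boundary_top.
have h1 : composable i a a'.
  exact: composable_par (parallel_sym pu) (parallel_refl _) h.
have h2 : composable i b b'.
  exact: composable_par (parallel_refl _) pv h.
by exists (comp h1), (comp h2); apply: comp_boundary_low.
Qed.

Lemma top_rep q : exists a b (u : term a b), q = class (Formal u).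
Proof. by rewrite -(repK q); case: (rep q) => a b u; exists a, b, u. Qed.

(* As [C] has no cells above dimension n, these are the k-cells of [C] for
   k <= n, the classes of formal composites for k = n.+1, and nothing above. *)
Inductive ext_cell : nat -> Type :=
| old k : C k -> ext_cell k
| new : top_cell -> ext_cell n.+1.

Lemma dim_absurd (k : nat) : C k -> k = n.+1 -> False.
Proof. by move=> /cell_dim /= le e; move: le; rewrite e ltnn. Qed.

Lemma ltnn_absurd : n < n -> False.
Proof. by rewrite ltnn. Qed.

Definition strip k (x : ext_cell k) : k <= n -> C k :=
  match x with
  | old k c => fun _ => c
  | new q => fun le => False_rect _ (ltnn_absurd le)
  end.

Definition to_top (x : ext_cell n.+1) : top_cell :=
  match x in ext_cell k return k = n.+1 -> top_cell with
  | old k c => fun e => False_rect _ (dim_absurd c e)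
  | new q => fun _ => q
  end erefl.

Definition ext_bd (d : forall k, C k.+1 -> C k) (dtop : top_cell -> C n) k
    (x : ext_cell k.+1) : ext_cell k :=
  match x in ext_cell m
    return match m return Type with 0 => unit | k.+1 => ext_cell k end with
  | old m c =>
      match m return C m ->
        match m return Type with 0 => unit | k.+1 => ext_cell k end with
      | 0 => fun _ => tt
      | k.+1 => fun c => old (d k c)
      end c
  | new q => old (dtop q)
  end.

Lemma ext_cellP k (x : ext_cell k) :
  (exists c : C k, x = old c) \/
  (exists (e : k = n.+1) (q : top_cell), ecast k (ext_cell k) e x = new q).
Proof. by case: x => [m c|q]; [left; exists c|right; exists erefl, q]. Qed.

Lemma stripK k (x : ext_cell k) (le : k <= n) : old (strip x le) = x.
Proof. by case: x le => //= q le; exfalso; move: le; rewrite ltnn. Qed.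

Lemma old_inj k : injective (@old k).
Proof.
by move=> c d e; have := congr1 (fun x => strip x (cell_dim c)) e.
Qed.

Lemma new_inj : injective new.
Proof. by move=> q r e; have := congr1 to_top e. Qed.

Lemma to_topK (x : ext_cell n.+1) : new (to_top x) = x.
Proof.
case: (ext_cellP x) => [[c _]|[e [q]]]; first by case: (dim_absurd c).
by rewrite (eq_irrelevance e erefl) /= => ->.
Qed.

End FreeExtension.

Arguments top_comp {n C G i q r} _.

Lemma ext_src_src n (C : ncat n) (G : generators C) k (x : ext_cell G k.+2) :
  let s := ext_bd (fun _ => src) (@top_src n C G) in
  let t := ext_bd (fun _ => tgt) (@top_tgt n C G) in
  s _ (s _ x) = s _ (t _ x).
Proof.
case: (ext_cellP x) => [[c ->] /=|[e [q]]]; first by rewrite src_src.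
case: (e) => e'; subst n; rewrite (eq_irrelevance e erefl) /= => -> /=.
by have [-> _] := top_parallel q.
Qed.

Lemma ext_tgt_src n (C : ncat n) (G : generators C) k (x : ext_cell G k.+2) :
  let s := ext_bd (fun _ => src) (@top_src n C G) in
  let t := ext_bd (fun _ => tgt) (@top_tgt n C G) in
  t _ (s _ x) = t _ (t _ x).
Proof.
case: (ext_cellP x) => [[c ->] /=|[e [q]]]; first by rewrite tgt_src.
case: (e) => e'; subst n; rewrite (eq_irrelevance e erefl) /= => -> /=.
by have [_ ->] := top_parallel q.
Qed.

Section FreeExtensionCat.
Variables (n : nat) (C : ncat n) (G : generators C).

Definition ext_glob : globular :=
  Globular (@ext_src_src n C G) (@ext_tgt_src n C G).

Lemma ext_dim k : ext_glob k -> within (Some n.+1) k.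
Proof. by case=> //= m c; apply/leqW/(cell_dim c). Qed.

Lemma composable_old i k (c d : C k) :
  composable i (X := ext_glob) (old G c) (old G d) <-> composable i c d.
Proof.
split; last exact: (@map_composable C ext_glob (@old n C G)).
apply: (@map_composableV C ext_glob (@old n C G)) => // m.
exact: old_inj.
Qed.

Lemma composable_new i (q r : top_cell G) :
  composable i (X := ext_glob) (new q) (new r) <-> top_composable i q r.
Proof.
split=> [h|[[-> e]|h]].
- have := composable_lt h; rewrite ltnS leq_eqVlt => /orP[/eqP ei|lt].
    left; split=> //; rewrite ei in h; apply: (@old_inj _ _ G).
    exact: (proj1 (composable_top _ _) h).
  by right; apply/composable_old; apply: (proj1 (composableS _ _ lt) h).
- by apply/(@composable_top ext_glob); rewrite /= e.
- have lt := composable_lt h; apply/(@composableS ext_glob _ _ _ _ lt).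
  exact/composable_old.
Qed.

Lemma ext_composable_strip i k (c : C k) (y : ext_cell G k) :
  composable i (X := ext_glob) (old G c) y ->
  composable i c (strip y (cell_dim c)).
Proof. by move=> h; apply/composable_old; rewrite stripK. Qed.

Lemma ext_composable_top i (q : top_cell G) (y : ext_cell G n.+1) :
  composable i (X := ext_glob) (new q) y -> top_composable i q (to_top y).
Proof. by move=> h; apply/composable_new; rewrite to_topK. Qed.

Definition ext_comp i k (x y : ext_glob k) (h : composable i x y) :
  ext_glob k :=
  match x in ext_cell _ k return
    forall y : ext_glob k, composable (X := ext_glob) i x y -> ext_glob k with
  | old k c => fun y h => old G (comp (ext_composable_strip h))
  | new q => fun y h => new (top_comp (ext_composable_top h))
  end y h.

Definition ext_unit k (b : k < n.+1) (x : ext_glob k) : ext_glob k.+1 :=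
  let c := strip x b in
  match k =P n with
  | ReflectT e =>
      ecast k (ext_cell G k.+1) (esym e)
        (new (class (Formal (tunit G (ecast k (C k) e c)))))
  | ReflectF ne => old G (@cunit (Some n) C k (leq_neq_lt ne b) c)
  end.

Definition free_precat : precat (Some n.+1) :=
  @Precat (Some n.+1) ext_glob ext_dim ext_unit ext_comp.


Lemma ext_unit_old k (b : within (Some n.+1) k.+1) (b' : within (Some n) k.+1)
  (c : C k) : @cunit _ free_precat k b (old G c) = old G (cunit b' c).
Proof.
rewrite /= /ext_unit /=; case: eqP => [e|ne].
  by exfalso; move: b' => /=; rewrite e ltnn.
by congr old; congr cunit; apply: bool_irrelevance.
Qed.

Lemma ext_unit_top (b : within (Some n.+1) n.+1) (c : C n) :
  @cunit _ free_precat n b (old G c) = new (class (Formal (tunit G c))).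
Proof.
rewrite /= /ext_unit /=; case: eqP => // e.
by rewrite (eq_irrelevance e erefl).
Qed.

Lemma ext_comp_old i k (c d : C k) h (h' : composable i c d) :
  @comp _ free_precat i k (old G c) (old G d) h = old G (comp h').
Proof. by rewrite /=; congr old; apply: comp_eq. Qed.

Lemma ext_comp_new i (q r : top_cell G) h (h' : top_composable i q r) :
  @comp _ free_precat i n.+1 (new q) (new r) h = new (top_comp h').
Proof. by rewrite /=; congr new; congr top_comp; apply: Prop_irrelevance. Qed.

Lemma ext_case k (x : ext_glob k) : k <= n \/ k = n.+1.
Proof.
have := ext_dim x; rewrite /= leq_eqVlt => /orP[/eqP ->|]; first by right.
by left.
Qed.

Lemma ext_oldP k (le : k <= n) (x : ext_glob k) : exists c : C k, x = old G c.
Proof. by exists (strip x le); rewrite stripK. Qed.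

Lemma ext_newP (x : ext_glob n.+1) : exists q : top_cell G, x = new q.
Proof. by exists (to_top x); rewrite to_topK. Qed.

Lemma ext_src_unit_to i k (le : i <= k) b b' (c : C k) :
  unit_to le b (src_to le (old G c : free_precat k)) =
  old G (unit_to le b' (src_to le c)).
Proof.
rewrite -(@map_src_to C ext_glob (@old n C G)) //.
by rewrite -(@map_unit_to _ _ C free_precat (@old n C G) _ _ _ le b') // => m b1 b2 x;
  rewrite -ext_unit_old.
Qed.

Lemma ext_tgt_unit_to i k (le : i <= k) b b' (c : C k) :
  unit_to le b (tgt_to le (old G c : free_precat k)) =
  old G (unit_to le b' (tgt_to le c)).
Proof.
rewrite -(@map_tgt_to C ext_glob (@old n C G)) //.
by rewrite -(@map_unit_to _ _ C free_precat (@old n C G) _ _ _ le b') // => m b1 b2 x;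
  rewrite -ext_unit_old.
Qed.

Lemma free_is_cat : is_cat free_precat.
Proof.
have P := catP C; split.
- move=> k b x; have := (b : is_true (k < n.+1)); rewrite ltnS leq_eqVlt => /orP[/eqP e|lt].
    subst k; have [c ->] := ext_oldP (leqnn n) x.
    by rewrite ext_unit_top /= top_src_class.
  have [c ->] := ext_oldP (ltnW lt) x.
  by rewrite (ext_unit_old _ lt) /= (src_unit P).
- move=> k b x; have := (b : is_true (k < n.+1)); rewrite ltnS leq_eqVlt => /orP[/eqP e|lt].
    subst k; have [c ->] := ext_oldP (leqnn n) x.
    by rewrite ext_unit_top /= top_tgt_class.
  have [c ->] := ext_oldP (ltnW lt) x.
  by rewrite (ext_unit_old _ lt) /= (tgt_unit P).
- move=> k x y h; case: (ext_case x) => [le|[e]].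
    have [c ex] := ext_oldP le x; have [d ey] := ext_oldP le y.
    subst x y; have h' := proj1 (composable_old _ _ _) h.
    by rewrite (ext_comp_old _ h') /= (src_comp_top P).
  subst k; have [q ex] := ext_newP x; have [r ey] := ext_newP y.
  subst x y; have h' := proj1 (composable_new _ _ _) h.
  rewrite (ext_comp_new _ h').
  have [a [b [u eq]]] := top_rep q; have [a' [b' [v er]]] := top_rep r.
  have [c [d [p ->]]] := top_compX h' eq er.
  rewrite eq /= !top_src_class /=.
  by case: (comp_boundary_topE p) => _ ->.
- move=> k x y h; case: (ext_case x) => [le|[e]].
    have [c ex] := ext_oldP le x; have [d ey] := ext_oldP le y.
    subst x y; have h' := proj1 (composable_old _ _ _) h.
    by rewrite (ext_comp_old _ h') /= (tgt_comp_top P).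
  subst k; have [q ex] := ext_newP x; have [r ey] := ext_newP y.
  subst x y; have h' := proj1 (composable_new _ _ _) h.
  rewrite (ext_comp_new _ h').
  have [a [b [u eq]]] := top_rep q; have [a' [b' [v er]]] := top_rep r.
  have [c [d [p ->]]] := top_compX h' eq er.
  rewrite er /= !top_tgt_class /=.
  by case: (comp_boundary_topE p) => _ _ ->.
- move=> i k x y h hs; case: (ext_case x) => [le|[e]].
    have [c ex] := ext_oldP le x; have [d ey] := ext_oldP le y.
    subst x y; have h' := proj1 (composable_old _ _ _) h.
    rewrite (ext_comp_old _ h') /=.
    have hs' := proj1 (composable_old _ _ _) hs.
    by rewrite (src_comp P h' hs') -(ext_comp_old hs hs').
  subst k; have lt := composable_lt hs.
  have [q ex] := ext_newP x; have [r ey] := ext_newP y.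
  subst x y; have h' := proj1 (composable_new _ _ _) h.
  have hs' := proj1 (composable_old _ _ _) hs.
  rewrite (ext_comp_new _ h') (ext_comp_old hs hs') /=.
  have [a [b [u eq]]] := top_rep q; have [a' [b' [v er]]] := top_rep r.
  have [c [d [p ->]]] := top_compX h' eq er.
  rewrite top_src_class /=; congr old.
  case: (comp_boundary_lowE lt p) => [k1 [k2 [-> _]]].
  by apply: comp_eq; rewrite ?eq ?er top_src_class.
- move=> i k x y h hs; case: (ext_case x) => [le|[e]].
    have [c ex] := ext_oldP le x; have [d ey] := ext_oldP le y.
    subst x y; have h' := proj1 (composable_old _ _ _) h.
    rewrite (ext_comp_old _ h') /=.
    have hs' := proj1 (composable_old _ _ _) hs.
    by rewrite (tgt_comp P h' hs') -(ext_comp_old hs hs').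
  subst k; have lt := composable_lt hs.
  have [q ex] := ext_newP x; have [r ey] := ext_newP y.
  subst x y; have h' := proj1 (composable_new _ _ _) h.
  have hs' := proj1 (composable_old _ _ _) hs.
  rewrite (ext_comp_new _ h') (ext_comp_old hs hs') /=.
  have [a [b [u eq]]] := top_rep q; have [a' [b' [v er]]] := top_rep r.
  have [c [d [p ->]]] := top_compX h' eq er.
  rewrite top_tgt_class /=; congr old.
  case: (comp_boundary_lowE lt p) => [k1 [k2 [_ ->]]].
  by apply: comp_eq; rewrite ?eq ?er top_tgt_class.
- move=> i k x y z; case: (ext_case x) => [le|e].
    have [c1 ->] := ext_oldP le x; have [c2 ->] := ext_oldP le y.
    have [c3 ->] := ext_oldP le z => h1 h2 h3 h4.
    have h1' := proj1 (composable_old _ _ _) h1.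
    have h3' := proj1 (composable_old _ _ _) h3.
    move: h2 h4; rewrite (ext_comp_old _ h1') (ext_comp_old _ h3') => h2 h4.
    have h2' := proj1 (composable_old _ _ _) h2.
    have h4' := proj1 (composable_old _ _ _) h4.
    by rewrite (ext_comp_old _ h2') (ext_comp_old _ h4') (compA P h2' h4').
  subst k; have [q1 ->] := ext_newP x; have [q2 ->] := ext_newP y.
  have [q3 ->] := ext_newP z => h1 h2 h3 h4.
  have h1' := proj1 (composable_new _ _ _) h1.
  have h3' := proj1 (composable_new _ _ _) h3.
  move: h2 h4; rewrite (ext_comp_new _ h1') (ext_comp_new _ h3') => h2 h4.
  have h2' := proj1 (composable_new _ _ _) h2.
  have h4' := proj1 (composable_new _ _ _) h4.
  rewrite (ext_comp_new _ h2') (ext_comp_new _ h4'); congr new.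
  have [a1 [b1 [u1 e1]]] := top_rep q1; have [a2 [b2 [u2 e2]]] := top_rep q2.
  have [a3 [b3 [u3 e3]]] := top_rep q3.
  have [? [? [p1 E1]]] := top_compX h1' e1 e2.
  have [? [? [p3 E3]]] := top_compX h3' e2 e3.
  have [? [? [p2 ->]]] := top_compX h2' E1 e3.
  have [? [? [p4 ->]]] := top_compX h4' e1 E3.
  by apply/classP; apply: cong_compA.
- move=> i k le x; case: (ext_case x) => [lek|e].
    have [c ->] := ext_oldP lek x.
    rewrite (ext_src_unit_to le _ (cell_dim c)) => h.
    have h' := proj1 (composable_old _ _ _) h.
    by rewrite (ext_comp_old _ h') (comp1x P).
  subst k; have [q ->] := ext_newP x => h.
  have lti := composable_lt h; move: h.
  have [a [b [u ->]]] := top_rep q.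
  rewrite (unit_toS (lti : i <= n) _ (leqnSn n : within (Some n.+1) n)).
  rewrite (src_toS (lti : i <= n)).
  have -> : src (new (class (Formal u)) : free_precat n.+1) = old G a.
    by rewrite /= top_src_class.
  rewrite (ext_src_unit_to _ _ (cell_dim a)) ext_unit_top => h.
  have h' := proj1 (composable_new _ _ _) h.
  rewrite (ext_comp_new _ h'); congr new.
  have [? [? [p ->]]] := top_compX h' erefl erefl.
  by apply/classP; apply: cong_comp1x.
- move=> i k le x; case: (ext_case x) => [lek|e].
    have [c ->] := ext_oldP lek x.
    rewrite (ext_tgt_unit_to le _ (cell_dim c)) => h.
    have h' := proj1 (composable_old _ _ _) h.
    by rewrite (ext_comp_old _ h') (compx1 P).
  subst k; have [q ->] := ext_newP x => h.
  have lti := composable_lt h; move: h.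
  have [a [b [u ->]]] := top_rep q.
  rewrite (unit_toS (lti : i <= n) _ (leqnSn n : within (Some n.+1) n)).
  rewrite (tgt_toS (lti : i <= n)).
  have -> : tgt (new (class (Formal u)) : free_precat n.+1) = old G b.
    by rewrite /= top_tgt_class.
  rewrite (ext_tgt_unit_to _ _ (cell_dim b)) ext_unit_top => h.
  have h' := proj1 (composable_new _ _ _) h.
  rewrite (ext_comp_new _ h'); congr new.
  have [? [? [p ->]]] := top_compX h' erefl erefl.
  by apply/classP; apply: cong_compx1.
- move=> i j k x y z t lt; case: (ext_case x) => [le|e].
    have [c1 ->] := ext_oldP le x; have [c2 ->] := ext_oldP le y.
    have [c3 ->] := ext_oldP le z; have [c4 ->] := ext_oldP le t => h1 h2 h3 h4.
    have h1' := proj1 (composable_old _ _ _) h1.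
    have h2' := proj1 (composable_old _ _ _) h2.
    have h3' := proj1 (composable_old _ _ _) h3.
    have h4' := proj1 (composable_old _ _ _) h4.
    rewrite (ext_comp_old _ h1') (ext_comp_old _ h2').
    rewrite (ext_comp_old _ h3') (ext_comp_old _ h4') => h5 h6.
    have h5' := proj1 (composable_old _ _ _) h5.
    have h6' := proj1 (composable_old _ _ _) h6.
    by rewrite (ext_comp_old _ h5') (ext_comp_old _ h6') (exchange P lt h5' h6').
  subst k; have [q1 ->] := ext_newP x; have [q2 ->] := ext_newP y.
  have [q3 ->] := ext_newP z; have [q4 ->] := ext_newP t => h1 h2 h3 h4.
  have h1' := proj1 (composable_new _ _ _) h1.
  have h2' := proj1 (composable_new _ _ _) h2.
  have h3' := proj1 (composable_new _ _ _) h3.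
  have h4' := proj1 (composable_new _ _ _) h4.
  rewrite (ext_comp_new _ h1') (ext_comp_new _ h2').
  rewrite (ext_comp_new _ h3') (ext_comp_new _ h4') => h5 h6.
  have h5' := proj1 (composable_new _ _ _) h5.
  have h6' := proj1 (composable_new _ _ _) h6.
  rewrite (ext_comp_new _ h5') (ext_comp_new _ h6'); congr new.
  have [a1 [b1 [u1 e1]]] := top_rep q1; have [a2 [b2 [u2 e2]]] := top_rep q2.
  have [a3 [b3 [u3 e3]]] := top_rep q3; have [a4 [b4 [u4 e4]]] := top_rep q4.
  have [? [? [p1 E1]]] := top_compX h1' e1 e2.
  have [? [? [p2 E2]]] := top_compX h2' e3 e4.
  have [? [? [p3 E3]]] := top_compX h3' e1 e3.
  have [? [? [p4 E4]]] := top_compX h4' e2 e4.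
  have [? [? [p5 ->]]] := top_compX h5' E1 E2.
  have [? [? [p6 ->]]] := top_compX h6' E3 E4.
  by apply/classP; apply: cong_exchange.
- move=> i k b x y h; have := (b : is_true (k < n.+1)); rewrite ltnS leq_eqVlt => /orP[/eqP e|lt].
    subst k; move: h; have [c ->] := ext_oldP (leqnn n) x.
    have [d ->] := ext_oldP (leqnn n) y => h.
    have h' := proj1 (composable_old _ _ _) h.
    rewrite (ext_comp_old _ h') !ext_unit_top => k.
    have k' := proj1 (composable_new _ _ _) k.
    rewrite (ext_comp_new _ k'); congr new.
    have [? [? [p ->]]] := top_compX k' erefl erefl.
    by apply/classP; apply: cong_unit_comp.
  move: h; have [c ->] := ext_oldP (ltnW lt) x.
  have [d ->] := ext_oldP (ltnW lt) y => h.
  have h' := proj1 (composable_old _ _ _) h.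
  rewrite (ext_comp_old _ h') !(ext_unit_old _ lt) => k1.
  have k1' := proj1 (composable_old _ _ _) k1.
  by rewrite (ext_comp_old _ k1') (unit_comp P _ k1').
Qed.

End FreeExtensionCat.

Definition free_cat n (C : ncat n) (G : generators C) : ncat n.+1 :=
  Cat (free_is_cat G).

(* The levels above n of a polygraph whose first levels generate [C]: a set of
   (n+1)-generators on [C], then a set of (n+2)-generators on the resulting
   free (n+1)-category, and so on. *)
#[projections(primitive)]
CoInductive tower (n : nat) (C : ncat n) : Type := Tower {
  tower_gen : generators C;
  tower_next : tower (free_cat tower_gen)
}.

Record polygraph := Polygraph {
  points : Type;
  higher : tower (discrete points)
}.

Section FreeComplex.
Variable S : polygraph.

Fixpoint stage (n : nat) : {C : ncat n & tower C} :=
  match n with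
  | 0 => existT _ (discrete (points S)) (higher S)
  | m.+1 =>
      let T := projT2 (stage m) in
      existT _ (free_cat (tower_gen T)) (tower_next T)
  end.

Definition free_ncat (n : nat) : ncat n := projT1 (stage n).
Definition stage_gen (n : nat) : generators (free_ncat n) :=
  tower_gen (projT2 (stage n)).

Local Notation F := free_ncat.
Local Notation inc n := (old (stage_gen n)).

(* [F n] and [F n.+1] agree up to dimension n through [inc n]. *)
Definition star_cell (n : nat) : Type := F n n.
Definition star_src n (x : star_cell n.+1) : star_cell n :=
  strip (src x : ext_cell (stage_gen n) n) (leqnn n).
Definition star_tgt n (x : star_cell n.+1) : star_cell n :=
  strip (tgt x : ext_cell (stage_gen n) n) (leqnn n).

Lemma inc_src n (x : star_cell n.+1) : inc n (star_src x) = src x.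
Proof. exact: stripK. Qed.

Lemma inc_tgt n (x : star_cell n.+1) : inc n (star_tgt x) = tgt x.
Proof. exact: stripK. Qed.

Lemma src_inc n k (x : F n k.+1) :
  src (inc n x : F n.+1 k.+1) = inc n (src x).
Proof. by []. Qed.

Lemma tgt_inc n k (x : F n k.+1) :
  tgt (inc n x : F n.+1 k.+1) = inc n (tgt x).
Proof. by []. Qed.

Lemma star_src_src n (x : star_cell n.+2) :
  star_src (star_src x) = star_src (star_tgt x).
Proof.
apply: (@old_inj n (F n) (stage_gen n)); rewrite !inc_src.
apply: (@old_inj n.+1 (F n.+1) (stage_gen n.+1)).
by rewrite -!src_inc inc_src inc_tgt src_src.
Qed.

Lemma star_tgt_src n (x : star_cell n.+2) :
  star_tgt (star_src x) = star_tgt (star_tgt x).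
Proof.
apply: (@old_inj n (F n) (stage_gen n)); rewrite !inc_tgt.
apply: (@old_inj n.+1 (F n.+1) (stage_gen n.+1)).
by rewrite -!tgt_inc inc_src inc_tgt tgt_src.
Qed.

Definition star_glob : globular := Globular star_src_src star_tgt_src.

Lemma composable_inc i n k (x y : F n k) :
  composable i (inc n x : F n.+1 k) (inc n y : F n.+1 k) <-> composable i x y.
Proof. exact: composable_old. Qed.

Lemma star_composable i n (x y : star_glob n) :
  composable i x y <-> composable i (x : F n n) (y : F n n).
Proof.
elim: n x y => [|n IH] x y; first by split=> /composable_lt.
case: (ltngtP i n) => [lt|gt|->].
- rewrite (composableS _ _ lt) (composableS (_ : F n.+1 n.+1) _ lt).
  by rewrite IH -(inc_tgt x) -(inc_src y) composable_inc.
- by split=> /composable_lt; rewrite ltnS leqNgt gt.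
- rewrite !composable_top -(inc_tgt x) -(inc_src y); split=> [e|].
    by congr old; exact: e.
  exact: (@old_inj n (F n) (stage_gen n)).
Qed.

Definition star_comp i n (x y : star_glob n) (h : composable i x y) :
  star_glob n := comp (proj1 (star_composable i x y) h).

Definition star_unit n (x : star_glob n) : star_glob n.+1 :=
  @cunit _ (F n.+1) n (leqnn n.+1) (inc n x).

Definition star_precat : precat None :=
  @Precat None star_glob (fun _ _ => isT) (fun n _ => @star_unit n) star_comp.

Lemma star_unit_src_to i n (le : i <= n) b b' (x : star_glob n) :
  unit_to le b (src_to le (x : star_precat n)) =
  unit_to le b' (src_to le (x : F n n)).
Proof.
elim: n le b b' x => [|n IH] le b b' x.
  have /eqP e : i == 0 by rewrite -leqn0.
  by subst i; rewrite !unit_to_refl !src_to_refl.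
case: (eqVneq i n.+1) => [e|ne].
  by subst i; rewrite !unit_to_refl !src_to_refl.
have le' : i <= n by apply: leq_neqS le; apply/eqP.
rewrite !(src_toS le') (unit_toS (C := star_precat) le' _ isT).
rewrite (IH le' isT (leqnn n)) (unit_toS le' _ (leqnSn n : within (Some n.+1) n)).
have -> : src (x : F n.+1 n.+1) = inc n (star_src x) by rewrite inc_src.
rewrite (ext_src_unit_to _ _ _ (leqnn n)) /= /star_unit.
by congr cunit; apply: bool_irrelevance.
Qed.

Lemma star_unit_tgt_to i n (le : i <= n) b b' (x : star_glob n) :
  unit_to le b (tgt_to le (x : star_precat n)) =
  unit_to le b' (tgt_to le (x : F n n)).
Proof.
elim: n le b b' x => [|n IH] le b b' x.
  have /eqP e : i == 0 by rewrite -leqn0.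
  by subst i; rewrite !unit_to_refl !tgt_to_refl.
case: (eqVneq i n.+1) => [e|ne].
  by subst i; rewrite !unit_to_refl !tgt_to_refl.
have le' : i <= n by apply: leq_neqS le; apply/eqP.
rewrite !(tgt_toS le') (unit_toS (C := star_precat) le' _ isT).
rewrite (IH le' isT (leqnn n)) (unit_toS le' _ (leqnSn n : within (Some n.+1) n)).
have -> : tgt (x : F n.+1 n.+1) = inc n (star_tgt x) by rewrite inc_tgt.
rewrite (ext_tgt_unit_to _ _ _ (leqnn n)) /= /star_unit.
by congr cunit; apply: bool_irrelevance.
Qed.

Lemma star_is_cat : is_cat star_precat.
Proof.
have P n := catP (F n).
have inj n k := @old_inj n (F n) (stage_gen n) k.
split.
- move=> n b x; apply: inj; rewrite inc_src.
  exact: (src_unit (P n.+1)).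
- move=> n b x; apply: inj; rewrite inc_tgt.
  exact: (tgt_unit (P n.+1)).
- move=> n x y h; apply: inj; rewrite !inc_src.
  exact: (src_comp_top (P n.+1)).
- move=> n x y h; apply: inj; rewrite !inc_tgt.
  exact: (tgt_comp_top (P n.+1)).
- move=> i n x y h h'; apply: inj; rewrite inc_src.
  have h1 := proj1 (star_composable _ _ _) h.
  have h2 := proj1 (star_composable _ _ _) h'.
  have h3 := composable_src (composable_lt h') h1.
  rewrite [LHS](src_comp (P n.+1) _ h3).
  move: h3; rewrite -!inc_src => h3.
  by rewrite [LHS](ext_comp_old _ h2); congr old; apply: comp_eq.
- move=> i n x y h h'; apply: inj; rewrite inc_tgt.
  have h1 := proj1 (star_composable _ _ _) h.
  have h2 := proj1 (star_composable _ _ _) h'.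
  have h3 := composable_tgt (composable_lt h') h1.
  rewrite [LHS](tgt_comp (P n.+1) _ h3).
  move: h3; rewrite -!inc_tgt => h3.
  by rewrite [LHS](ext_comp_old _ h2); congr old; apply: comp_eq.
- by move=> i n x y z h1 h2 h3 h4; apply: (compA (P n)).
- move=> i n le x; rewrite (star_unit_src_to le _ (cell_dim (x : F n n))) => h.
  exact: (comp1x (P n)).
- move=> i n le x; rewrite (star_unit_tgt_to le _ (cell_dim (x : F n n))) => h.
  exact: (compx1 (P n)).
- by move=> i j n x y z t lt h1 h2 h3 h4 h5 h6; apply: (exchange (P n)).
- move=> i n b x y h h'.
  have k1 := proj1 (star_composable _ _ _) h.
  have k2 := proj2 (composable_inc _ _ _) k1.
  have k3 := proj1 (star_composable _ _ _) h'.
  rewrite /= /star_unit.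
  have <- : comp k2 = inc n (star_comp h).
    by rewrite [LHS](ext_comp_old _ k1); congr old; apply: comp_eq.
  exact: (unit_comp (P n.+1)).
Qed.

Definition free_complex : complex := Cat star_is_cat.

End FreeComplex.

Definition Fcompl : category :=
  full_subcategory (K := Compl) (fun C => exists S, C = free_complex S).

(* Main.v *)
From mathcomp Require Import all_boot.
From mathcomp Require Import boolp.
Require Import Defs.

Set Implicit Arguments.
Unset Strict Implicit.
Unset Printing Implicit Defensive.

(** Let [X] be the free complex of a polygraph [S] and [h] an idempotent
endomorphism of [X].  In the category of complexes [h] splits through the
subcomplex of its fixed cells, so the point is that this subcomplex is free.
A basis [T] is built one dimension at a time.

Every function from the (n+1)-generators to nat extends to an additive weight
on (n+1)-cells that vanishes on units ([weight]), and a cell in which no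
generator occurs is a unit ([weight0]).  Hence [h] acts on (n+1)-cells like an
idempotent matrix with natural entries.  Call a generator collapsed if [h]
sends it to a unit, visible otherwise.  Idempotency forces the image of every
visible generator to contain at least one visible generator, and counting
shows that a visible generator [g] which occurs in a fixed cell is persistent:
[h g] contains exactly one visible generator, counted with multiplicity, and
it is [g] itself ([fixed_persistent]).  So each fixed (n+1)-cell is a
composite of units and of cells [h g] with [g] persistent ([step_img_top]):
the cells [h g], for [g] persistent, are the candidates for the
(n+1)-generators of [T].

Freeness says that the functor [step_fun] from the category freely generated
by them into [X] is injective in dimension n+1.  Choosing preimages of the
cells [h g], for all generators [g] of [X], gives a functor [ret] in the other
direction, defined on the category of cells of [X] of dimension at most n+1,
such that [step_fun] after [ret] is [h].  It is to be shown that [ret] after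
[step_fun] is the identity.  By freeness it is enough to compare the two on a
generator, which amounts to proving that a cell [y] with the same image as a
generator [t] is [t] ([step_fun_gen_inj]).  Such a [y] has weight one, so it
is [t] composed with units on cells of dimension at most n, that is, a context
around [t] ([weight1]).  The k-dimensional sources of [y] and [t] have images
of the same length, which forces the k-dimensional cells of the context to
have length zero, hence to be units on cells of dimension k-1; descending on
k, the context disappears ([context_trivial]).

The step from n to n+1 thus turns an n-category isomorphic to the fixed cells
of dimension at most n into such an (n+1)-category that is free over it, and
[T] is obtained by iterating it coinductively ([build]). *)

(** * Functors and total composition *)

(** The two bounds on dimensions may differ: free n-categories are mapped to
complexes below. *)
Record functor N M (C : cat N) (D : cat M) := Functor {
  fmap :> forall n, C n -> D n;
  fmap_src : forall n (x : C n.+1), fmap (src x) = src (fmap x);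
  fmap_tgt : forall n (x : C n.+1), fmap (tgt x) = tgt (fmap x);
  fmap_unit : forall n b b' (x : C n), fmap (cunit b x) = cunit b' (fmap x);
  fmap_comp : forall i n (x y : C n) (h : composable i x y)
    (h' : composable i (fmap x) (fmap y)), fmap (comp h) = comp h'
}.

(** Injectivity is asked for in the dimension [i] of the common boundary only,
so that the lemma applies to functors not yet known to be injective at the
top. *)
Lemma reflect_composable (X Y : globular) (f : forall n, X n -> Y n)
    (f_src : forall n (x : X n.+1), f _ (src x) = src (f _ x))
    (f_tgt : forall n (x : X n.+1), f _ (tgt x) = tgt (f _ x))
    i n (x y : X n) : injective (@f i) ->
  composable i (f _ x) (f _ y) -> composable i x y.
Proof.
move=> inj [lt]; rewrite -(map_tgt_to f_tgt) -(map_src_to f_src) => /inj.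
by exists lt.
Qed.

Section TotalComposition.
Variables (N : option nat) (C : precat N).

(** Composition made total by an arbitrary value, so that composites can be
rewritten without carrying proofs of composability. *)
Definition pcomp i n (x y : C n) : C n :=
  if pselect (composable i x y) is left h then comp h else x.

Lemma pcompE i n (x y : C n) (h : composable i x y) : comp h = pcomp i x y.
Proof. by rewrite /pcomp; case: pselect => // h'; apply: comp_eq. Qed.

End TotalComposition.

Section PcompLaws.
Variables (N : option nat) (C : cat N).
Implicit Types (i j n : nat).

Lemma src_pcomp_top n (x y : C n.+1) : composable n x y ->
  src (pcomp n x y) = src x.
Proof. by move=> h; rewrite -(pcompE h) (src_comp_top (catP C)). Qed.

Lemma tgt_pcomp_top n (x y : C n.+1) : composable n x y ->
  tgt (pcomp n x y) = tgt y.
Proof. by move=> h; rewrite -(pcompE h) (tgt_comp_top (catP C)). Qed.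

Lemma src_pcomp i n (x y : C n.+1) : i < n -> composable i x y ->
  src (pcomp i x y) = pcomp i (src x) (src y).
Proof.
move=> lt h; rewrite -(pcompE h) -(pcompE (composable_src lt h)).
exact: (src_comp (catP C)).
Qed.

Lemma tgt_pcomp i n (x y : C n.+1) : i < n -> composable i x y ->
  tgt (pcomp i x y) = pcomp i (tgt x) (tgt y).
Proof.
move=> lt h; rewrite -(pcompE h) -(pcompE (composable_tgt lt h)).
exact: (tgt_comp (catP C)).
Qed.

Lemma pcomp1x i n (le : i <= n) b (x : C n) :
  composable i (unit_to le b (src_to le x)) x ->
  pcomp i (unit_to le b (src_to le x)) x = x.
Proof.
rewrite (bool_irrelevance b (cell_dim x)) => h.
by rewrite -(pcompE h) (comp1x (catP C)).
Qed.

Lemma pcompx1 i n (le : i <= n) b (x : C n) :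
  composable i x (unit_to le b (tgt_to le x)) ->
  pcomp i x (unit_to le b (tgt_to le x)) = x.
Proof.
rewrite (bool_irrelevance b (cell_dim x)) => h.
by rewrite -(pcompE h) (compx1 (catP C)).
Qed.

Lemma composable_cunit i n b (x y : C n) :
  composable i x y -> composable i (cunit b x) (cunit b y).
Proof.
move=> h; apply/(composableS _ _ (composable_lt h)).
by rewrite (src_unit (catP C)) (tgt_unit (catP C)).
Qed.

Lemma cunit_pcomp i n b (x y : C n) : composable i x y ->
  cunit b (pcomp i x y) = pcomp i (cunit b x) (cunit b y).
Proof.
move=> h; rewrite -(pcompE h) -(pcompE (composable_cunit b h)).
exact: (unit_comp (catP C)).
Qed.

End PcompLaws.

Section FunctorTheory.
Variables (N M : option nat) (C : cat N) (D : cat M) (f : functor C D).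

Lemma fmap_composable i n (x y : C n) :
  composable i x y -> composable i (f n x) (f n y).
Proof. exact: (map_composable (fmap_src f) (fmap_tgt f)). Qed.

Lemma fmap_pcomp i n (x y : C n) : composable i x y ->
  f n (pcomp i x y) = pcomp i (f n x) (f n y).
Proof.
move=> h; rewrite -(pcompE h) -(pcompE (fmap_composable h)).
exact: fmap_comp.
Qed.

Lemma fmap_src_to i n (le : i <= n) (x : C n) :
  f i (src_to le x) = src_to le (f n x).
Proof. exact: (map_src_to (fmap_src f)). Qed.

Lemma fmap_tgt_to i n (le : i <= n) (x : C n) :
  f i (tgt_to le x) = tgt_to le (f n x).
Proof. exact: (map_tgt_to (fmap_tgt f)). Qed.

Lemma fmap_unit_to i n (le : i <= n) b b' (x : C i) :
  f n (unit_to le b x) = unit_to le b' (f i x).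
Proof. by apply: (@map_unit_to _ _ C D f) => *; apply: fmap_unit. Qed.

End FunctorTheory.

(** * Cells of a free extension: induction, weights, functors *)

Section FreeCells.
Variables (n : nat) (C : ncat n) (G : generators C).
Local Notation E := (free_cat G).

Definition gen_cell (x : G) : E n.+1 := new (class (Formal (tgen x))).

Definition incl k (c : C k) : E k := old G c.

Lemma term_composable i a b a' b' c d (p : comp_boundary i a b a' b' c d)
    (u : term G a b) (v : term G a' b') :
  composable i (new (class (Formal u)) : E n.+1) (new (class (Formal v))).
Proof.
apply/composable_new; rewrite /top_composable top_tgt_class top_src_class /=.
case: p => [-> ->|h h']; [by left | right].
exact: composable_par (parallel_refl _) (parallel_sym (term_parallel v)) h'.
Qed.

Lemma pcomp_class i a b a' b' c d (p : comp_boundary i a b a' b' c d)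
    (u : term G a b) (v : term G a' b') :
  new (class (Formal (tcomp p u v))) =
  pcomp i (new (class (Formal u)) : E n.+1) (new (class (Formal v))).
Proof.
have h := term_composable p u v.
rewrite -(pcompE h).
rewrite [RHS](ext_comp_new h (proj1 (composable_new _ _ _) h)).
by congr new; rewrite (top_compE _ p erefl erefl).
Qed.

Lemma cunit_class b (c : C n) :
  @cunit _ E n b (incl c) = new (class (Formal (tunit G c))).
Proof. exact: ext_unit_top. Qed.

(** Composites of classes are classes of composites, so that induction on
terms descends to the quotient. *)
Lemma free_ind (P : E n.+1 -> Prop) :
  (forall x, P (gen_cell x)) ->
  (forall b c, P (@cunit _ E n b (incl c))) ->
  (forall i x y, composable i x y -> P x -> P y -> P (pcomp i x y)) ->
  forall x, P x.
Proof.
move=> Pg Pu Pc x; have [q ->] := ext_newP x; have [a [b [u ->]]] := top_rep q.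
elim: {q x} a b / u => [x|a|i a b a' b' c d p u Pu1 v Pv].
- exact: Pg.
- by rewrite -(cunit_class (leqnn n.+1)).
- by rewrite pcomp_class; apply: Pc => //; exact: (term_composable p).
Qed.

Fixpoint term_weight (phi : G -> nat) a b (u : term G a b) : nat :=
  match u with
  | tgen x => phi x
  | tunit _ => 0
  | tcomp _ _ _ _ _ _ _ _ u v => term_weight phi u + term_weight phi v
  end.

Lemma cong_term_weight phi a b a' b' (u : term G a b) (v : term G a' b') :
  cong u v -> term_weight phi u = term_weight phi v.
Proof.
elim=> //=.
- by move=> *; congruence.
- by move=> *; congruence.
- by move=> *; rewrite addnA.
- by move=> *; rewrite addn0.
- by move=> *; rewrite addnACA.
Qed.

(** Each axiom of (n+1)-categories preserves the number of occurrences of each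
generator; a weighted count of occurrences is therefore well defined on cells.
*)
Definition weight (phi : G -> nat) (x : E n.+1) : nat :=
  term_weight phi (fterm (rep (to_top x))).

Lemma weight_class phi a b (u : term G a b) :
  weight phi (new (class (Formal u))) = term_weight phi u.
Proof. exact/cong_term_weight/(rep_class (Formal u)). Qed.

Lemma weight_gen phi x : weight phi (gen_cell x) = phi x.
Proof. exact: weight_class. Qed.

Lemma weight_unit phi b c : weight phi (@cunit _ E n b c) = 0.
Proof.
have [c' ->] := ext_oldP (leqnn n) c.
by rewrite [cunit _ _]cunit_class weight_class.
Qed.

Lemma weight_pcomp phi i x y : composable i x y ->
  weight phi (pcomp i x y) = weight phi x + weight phi y.
Proof.
have [q ->] := ext_newP x; have [a [b [u eq]]] := top_rep q.
have [r ->] := ext_newP y; have [a' [b' [v er]]] := top_rep r => h.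
have h' := proj1 (composable_new _ _ _) h.
rewrite -(pcompE h) [comp h](ext_comp_new h h').
have [c [d [p ->]]] := top_compX h' eq er.
by rewrite eq er !weight_class.
Qed.

End FreeCells.

(** The universal property of the free extension: a functor on [C] and values
for the generators with the right boundaries determine a functor on [free_cat
G]. *)
Section Extend.
Variables (n : nat) (C : ncat n) (G : generators C).
Variables (M : option nat) (D : cat M) (bM : within M n.+1).
Variables (f : functor C D) (g : G -> D n.+1).
Hypothesis g_src : forall x, src (g x) = f n (gsrc x).
Hypothesis g_tgt : forall x, tgt (g x) = f n (gtgt x).

Fixpoint eval a b (u : term G a b) : D n.+1 :=
  match u with
  | tgen x => g x
  | tunit a => cunit bM (f n a)
  | tcomp i _ _ _ _ _ _ _ u v => pcomp i (eval u) (eval v)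
  end.

Lemma composable_bd i a b a' b' c d (p : comp_boundary i a b a' b' c d)
    (x y : D n.+1) : tgt x = f n b -> src y = f n a' -> parallel a' b' ->
  composable i x y.
Proof.
move=> ex ey par; case/comp_boundaryE: p => [[-> eb _ _]|[h [h' _]]].
  by apply/composable_top; rewrite ex ey eb.
apply/(composableS _ _ (composable_lt h)); rewrite ex ey.
apply: fmap_composable.
exact: composable_par (parallel_refl _) (parallel_sym par) h'.
Qed.

Lemma eval_bd a b (u : term G a b) :
  src (eval u) = f n a /\ tgt (eval u) = f n b.
Proof.
elim: u => {a b} [x|a|i a b a' b' c d p u [su tu] v [sv tv]] /=.
- by rewrite g_src g_tgt.
- by rewrite (src_unit (catP D)) (tgt_unit (catP D)).
have h := composable_bd p tu sv (term_parallel v).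
case/comp_boundaryE: p => [[ei eb -> ->]|[k [k' [-> ->]]]].
  by subst i; rewrite src_pcomp_top // tgt_pcomp_top.
have lt := composable_lt k.
by rewrite src_pcomp // tgt_pcomp // su tu sv tv !pcompE !fmap_pcomp.
Qed.

Lemma eval_composable i a b a' b' c d (p : comp_boundary i a b a' b' c d)
    (u : term G a b) (v : term G a' b') : composable i (eval u) (eval v).
Proof.
by apply: (composable_bd p); [exact: (eval_bd u).2 | exact: (eval_bd v).1 |
  exact: term_parallel v].
Qed.

(** Each axiom generating the congruence holds in [D]. *)
Lemma eval_cong a b a' b' (u : term G a b) (v : term G a' b') :
  cong u v -> eval u = eval v.
Proof.
elim=> {a b a' b' u v} //=.
- by move=> *; congruence.
- by move=> i a b a' b' c d a1 b1 a1' b1' c1 d1 p u v q u1 v1 _ -> _ ->.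
- move=> i a b a' b' a'' b'' c d c' d' e f' e' f'' u v w uv uv_w vw u_vw.
  have h1 := eval_composable uv u v; have h2 := eval_composable vw v w.
  have h3 := eval_composable uv_w (tcomp uv u v) w.
  have h4 := eval_composable u_vw u (tcomp vw v w).
  move: h3 h4; rewrite /= -(pcompE h1) -(pcompE h2) => h3 h4.
  by rewrite -(pcompE h3) -(pcompE h4); apply: (compA (catP D)).
- move=> i le a b c d u p.
  have := eval_composable p (tunit G _) u; move=> /=.
  have leS := leqW le.
  have -> : cunit bM (f n (unit_to le (cell_dim a) (src_to le a))) =
            unit_to leS bM (src_to leS (eval u)).
    rewrite (src_toS le) (unit_toS le _ (withinW bM)) (eval_bd u).1.
    by rewrite (fmap_unit_to _ _ _ (withinW bM)) fmap_src_to.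
  exact: pcomp1x.
- move=> i le a b c d u p.
  have := eval_composable p u (tunit G _); move=> /=.
  have leS := leqW le.
  have -> : cunit bM (f n (unit_to le (cell_dim b) (tgt_to le b))) =
            unit_to leS bM (tgt_to leS (eval u)).
    rewrite (tgt_toS le) (unit_toS le _ (withinW bM)) (eval_bd u).2.
    by rewrite (fmap_unit_to _ _ _ (withinW bM)) fmap_tgt_to.
  exact: pcompx1.
- move=> i j a1 b1 a2 b2 a3 b3 a4 b4 c12 d12 c34 d34 c13 d13 c24 d24 c d c' d'.
  move=> x y z t xy zt xz yt xy_zt xz_yt lt.
  have h1 := eval_composable xy x y; have h2 := eval_composable zt z t.
  have h3 := eval_composable xz x z; have h4 := eval_composable yt y t.
  have h5 := eval_composable xy_zt (tcomp xy x y) (tcomp zt z t).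
  have h6 := eval_composable xz_yt (tcomp xz x z) (tcomp yt y t).
  move: h5 h6; rewrite /= -(pcompE h1) -(pcompE h2) -(pcompE h3) -(pcompE h4).
  move=> h5 h6; rewrite -(pcompE h5) -(pcompE h6).
  exact: (exchange (catP D)).
- move=> i a b h c d p.
  by rewrite pcompE fmap_pcomp // cunit_pcomp //; apply: fmap_composable.
Qed.

Definition extend_map k (x : free_cat G k) : D k :=
  match x with
  | old k c => f k c
  | new q => eval (fterm (rep q))
  end.

Lemma extend_map_class a b (u : term G a b) :
  extend_map (new (class (Formal u)) : free_cat G n.+1) = eval u.
Proof. exact/eval_cong/(rep_class (Formal u)). Qed.

Lemma extend_map_src k (x : free_cat G k.+1) :
  extend_map (src x) = src (extend_map x).
Proof.
case: (ext_case x) => [le|[e]].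
  by have [c ->] := ext_oldP le x; rewrite /= fmap_src.
subst k; have [q ->] := ext_newP x; have [a [b [u ->]]] := top_rep q.
by rewrite extend_map_class (eval_bd u).1 /= top_src_class.
Qed.

Lemma extend_map_tgt k (x : free_cat G k.+1) :
  extend_map (tgt x) = tgt (extend_map x).
Proof.
case: (ext_case x) => [le|[e]].
  by have [c ->] := ext_oldP le x; rewrite /= fmap_tgt.
subst k; have [q ->] := ext_newP x; have [a [b [u ->]]] := top_rep q.
by rewrite extend_map_class (eval_bd u).2 /= top_tgt_class.
Qed.

Lemma extend_map_unit k b b' (x : free_cat G k) :
  extend_map (cunit b x) = cunit b' (extend_map x).
Proof.
have := (b : is_true (k < n.+1)); rewrite ltnS leq_eqVlt => /orP[/eqP e|lt].
  subst k; have [c ->] := ext_oldP (leqnn n) x.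
  rewrite [cunit b _](@cunit_class n C G) extend_map_class /=.
  by rewrite (bool_irrelevance bM b').
have [c ->] := ext_oldP (ltnW lt) x.
rewrite [cunit b _](@ext_unit_old n C G _ _ lt).
exact: (fmap_unit f).
Qed.

Lemma extend_map_comp i k (x y : free_cat G k) (h : composable i x y)
  (h' : composable i (extend_map x) (extend_map y)) :
  extend_map (comp h) = comp h'.
Proof.
case: (ext_case x) => [le|e].
  have [c ex] := ext_oldP le x; have [d ey] := ext_oldP le y.
  subst x y; have k' := proj1 (composable_old G _ _ _) h.
  by rewrite [comp h](ext_comp_old h k') !pcompE /= fmap_pcomp.
subst k; have [q ex] := ext_newP x; have [a [b [u eq]]] := top_rep q.
have [r ey] := ext_newP y; have [a' [b' [v er]]] := top_rep r; subst x y.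
have k := proj1 (composable_new _ _ _) h.
rewrite [comp h](ext_comp_new h k).
have [c [d [p ->]]] := top_compX k eq er.
rewrite extend_map_class pcompE /=.
by congr pcomp; [rewrite eq | rewrite er]; rewrite -extend_map_class.
Qed.

Definition extend : functor (free_cat G) D :=
  Functor extend_map_src extend_map_tgt extend_map_unit extend_map_comp.

Lemma extend_gen x : extend n.+1 (gen_cell x) = g x.
Proof. exact: extend_map_class. Qed.

End Extend.

(** * Degenerate cells and contexts *)

(** Iterated boundaries and units do not reduce on [n.+1]; this principle
follows the two equations that they satisfy. *)
Lemma leq_dep_ind (P : forall i n, i <= n -> Prop) :
  (forall i (le : i <= i), P i i le) ->
  (forall i n (le : i <= n) (leS : i <= n.+1), P i n le -> P i n.+1 leS) ->
  forall i n (le : i <= n), P i n le.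
Proof.
move=> P0 PS i n; elim: n => [|n IH] le.
  by have e : i = 0 by [apply/eqP; rewrite -leqn0]; subst i; apply: P0.
case: (eqVneq i n.+1) => [e|ne]; first by subst i; apply: P0.
have le' : i <= n by apply: leq_neqS le; apply/eqP.
exact: PS (IH le').
Qed.

Section Degenerate.
Variables (N : option nat) (E : cat N).

Lemma tgt_unit_to i n (le : i <= n) b (c : E i) :
  tgt_to le (unit_to le b c) = c.
Proof.
move: i n le b c; apply: leq_dep_ind => [i le|i n le leS IH] b c.
  by rewrite unit_to_refl tgt_to_refl.
by rewrite (unit_toS le _ (withinW b)) (tgt_toS le) (tgt_unit (catP E)) IH.
Qed.

Lemma src_src_to i n (lt : i < n) (x : E n) :
  src (src_to lt x) = src_to (ltnW lt) x.
Proof.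
case: n lt x => // n lt x; have le : i <= n := lt; move: i n le lt x.
apply: leq_dep_ind => [i le|i n le leS IH] lt x.
  by rewrite src_to_refl (src_toS le) src_to_refl.
rewrite (src_toS (le : i.+1 <= n.+1)) (IH le) (src_toS (leqW le)).
by congr src_to; apply: bool_irrelevance.
Qed.

Lemma unit_to_cunit i n (lt : i < n) b b' (c : E i) :
  unit_to lt b (cunit b' c) = unit_to (ltnW lt) b c.
Proof.
case: n lt b => // n lt b; have le : i <= n := lt; move: i n le lt b b' c.
apply: leq_dep_ind => [i le|i n le leS IH] lt b b' c.
  rewrite unit_to_refl (unit_toS le _ (withinW b)) unit_to_refl.
  by congr cunit; apply: bool_irrelevance.
rewrite (unit_toS (le : i.+1 <= n.+1) _ (withinW b)) (IH le).
rewrite (unit_toS (leqW le) _ (withinW b)).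
by congr cunit; congr unit_to; apply: bool_irrelevance.
Qed.

Lemma src_to_pcomp k n (le : k <= n) i (x y : E n) : i < k ->
  composable i x y ->
  src_to le (pcomp i x y) = pcomp i (src_to le x) (src_to le y).
Proof.
move: k n le x y; apply: leq_dep_ind => [k le|k n le leS IH] x y lt h.
  by rewrite !src_to_refl.
have ltn : i < n := leq_trans lt le.
by rewrite !(src_toS le) src_pcomp // IH //; apply: composable_src.
Qed.

Lemma composable_src_to k n (le : k <= n) i (x y : E n) : i < k ->
  composable i x y -> composable i (src_to le x) (src_to le y).
Proof.
move: k n le x y; apply: leq_dep_ind => [k le|k n le leS IH] x y lt h.
  by rewrite !src_to_refl.
have ltn : i < n := leq_trans lt le.
by rewrite !(src_toS le); apply: IH => //; apply: composable_src.
Qed.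

(** An iterated unit of a k-cell is that of its own k-dimensional source. *)
Definition degenerate k n (x : E n) : Prop :=
  forall le : k <= n, x = unit_to le (cell_dim x) (src_to le x).

Lemma degenerate_tgt k n (le : k <= n) (x : E n) :
  degenerate k x -> tgt_to le x = src_to le x.
Proof. by move=> dx; rewrite {1}(dx le) tgt_unit_to. Qed.

Lemma degenerateS k n (lt : k < n) (x : E n) b :
  degenerate k.+1 x ->
  src_to lt x = cunit b (src (src_to lt x)) -> degenerate k x.
Proof.
move=> dx e le; rewrite {1}(dx lt) e unit_to_cunit src_src_to.
by rewrite (bool_irrelevance (ltnW lt) le).
Qed.

(** The unit laws: the i-cell underlying [x] is the i-source of [y]. *)
Lemma pcomp_degl i n (x y : E n) : degenerate i x ->
  composable i x y -> pcomp i x y = y.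
Proof.
move=> dx h; have [lt e] := h; move: h; rewrite (dx (ltnW lt)).
by rewrite -(degenerate_tgt _ dx) e => h; apply: pcomp1x.
Qed.

Lemma pcomp_degr i n (x y : E n) : degenerate i y ->
  composable i x y -> pcomp i x y = x.
Proof.
move=> dy h; have [lt e] := h; move: h; rewrite (dy (ltnW lt)) -e => h.
exact: pcompx1.
Qed.

End Degenerate.

Section Contexts.
Variables (N : option nat) (E : cat N) (m : nat) (t : E m).

(** Cells obtained from [t] by composing with units on k-cells only, along
dimensions less than k.  For k = 0 no composition is left. *)
Inductive context (k : nat) : E m -> Prop :=
| context_hole : context k t
| context_l i b y : i < k -> degenerate k b -> composable i b y ->
    context k y -> context k (pcomp i b y)
| context_r i b y : i < k -> degenerate k b -> composable i y b ->
    context k y -> context k (pcomp i y b).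

(** [mu] stands for the length of the source of dimension k.+1: it is additive
for compositions along lower dimensions, and a (k+1)-cell of length zero is a
unit. *)
Definition detects (k : nat) (mu : E m -> nat) : Prop :=
  (forall i x y, i <= k -> composable i x y ->
     mu (pcomp i x y) = mu x + mu y) /\
  (forall b, degenerate k.+1 b -> mu b = 0 -> degenerate k b).

(** [mu y] is [mu t] plus the contributions of the cells of the context.  If
these contributions vanish, each of these cells is a unit on a k-cell: it is
absorbed when composed along k, and remains part of a context of lower
dimension otherwise. *)
Lemma context_lower k mu y : detects k mu -> context k.+1 y ->
  mu t <= mu y /\ (mu y = mu t -> context k y).
Proof.
move=> [mu_add mu0].
elim=> {y} [|i b y lt db h _ [le IH]|i b y lt db h _ [le IH]].
- by split=> // _; apply: context_hole.
- rewrite mu_add //; split; first exact: leq_trans le (leq_addl _ _).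
  move=> e; have b0 : mu b = 0.
    apply/eqP; rewrite -leqn0 -(leq_add2r (mu y)) e add0n; exact: le.
  move: e; rewrite b0 add0n => /IH cy.
  have db' := mu0 b db b0.
  move: lt; rewrite ltnS leq_eqVlt => /orP[/eqP e|lt].
    by subst i; rewrite pcomp_degl.
  exact: context_l.
- rewrite mu_add //; split; first exact: leq_trans le (leq_addr _ _).
  move=> e; have b0 : mu b = 0.
    apply/eqP; rewrite -leqn0 -(leq_add2l (mu y)) e addn0; exact: le.
  move: e; rewrite b0 addn0 => /IH cy.
  have db' := mu0 b db b0.
  move: lt; rewrite ltnS leq_eqVlt => /orP[/eqP e|lt].
    by subst i; rewrite pcomp_degr.
  exact: context_r.
Qed.

Lemma context_trivial k y : context k y ->
  (forall j, j < k -> exists2 mu, detects j mu & mu y = mu t) -> y = t.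
Proof.
elim: k => [|k IH] cy mus; first by case: cy.
have [mu dmu e] := mus k (ltnSn k).
by apply: IH => [|j lt]; [apply: (context_lower dmu cy).2 | apply/mus/ltnW].
Qed.

End Contexts.

Section FreeWeight.
Variables (n : nat) (C : ncat n) (G : generators C).
Local Notation E := (free_cat G).
Local Notation total := (weight (fun _ : G => 1)).

Lemma degenerate_cunit N (D : cat N) k b (c : D k) : degenerate k (cunit b c).
Proof.
move=> le; rewrite (unit_toS (leqnn k) _ (withinW b)) (src_toS (leqnn k)).
rewrite unit_to_refl src_to_refl (src_unit (catP D)).
by congr cunit; apply: bool_irrelevance.
Qed.

Lemma pcomp_cunit N (D : cat N) i k b (x y : D k) :
  composable i (cunit b x) (cunit b y) ->
  exists z, pcomp i (cunit b x) (cunit b y) = cunit b z.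
Proof.
move=> h; have := composable_lt h; rewrite ltnS leq_eqVlt => /orP[/eqP e|lt].
  by subst i; exists y; apply: pcomp_degl => //; apply: degenerate_cunit.
exists (pcomp i x y); rewrite cunit_pcomp //.
move/(composableS _ _ lt): h.
by rewrite (src_unit (catP D)) (tgt_unit (catP D)).
Qed.

(** Composites of units are units. *)
Lemma weight0 (x : E n.+1) : total x = 0 ->
  forall b, exists c, x = @cunit _ E n b c.
Proof.
move: x; apply: free_ind => [x|b c|i x y h IHx IHy].
- by rewrite weight_gen.
- by move=> _ b'; exists (incl G c); congr cunit; apply: bool_irrelevance.
rewrite weight_pcomp // => /eqP; rewrite addn_eq0.
move=> /andP[/eqP /IHx x0 /eqP /IHy y0] b.
have [c ex] := x0 b; have [d ey] := y0 b; subst x y; exact: pcomp_cunit.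
Qed.

(** In a composite of total weight one all factors but one have weight zero,
hence are units on n-cells. *)
Lemma weight1 (x : E n.+1) : total x = 1 ->
  exists g : G, context (gen_cell g) n x.
Proof.
move: x; apply: free_ind => [x|b c|i x y h IHx IHy].
- by move=> _; exists x; apply: context_hole.
- by rewrite weight_unit.
have deg z : total z = 0 -> degenerate n z.
  by move=> /weight0 /(_ (leqnn n.+1)) [c ->]; apply: degenerate_cunit.
have := composable_lt h; rewrite ltnS leq_eqVlt.
rewrite weight_pcomp //; case ex: (total x) => [|[|//]].
  rewrite add0n => /orP[/eqP e|lt] /IHy [g cg]; exists g.
    by subst i; rewrite pcomp_degl //; apply: deg.
  by apply: context_l => //; apply: deg.
rewrite addSn => H [ey]; have [g cg] := IHx ex; exists g.
case/orP: H => [/eqP e|lt].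
  by subst i; rewrite pcomp_degr //; apply: deg.
by apply: context_r => //; apply: deg.
Qed.

End FreeWeight.

(** * The free complex as union of its stages *)

Section Star.
Variable S : polygraph.
Local Notation X := (free_complex S).
Local Notation F := (free_ncat S).

Lemma star_pcomp i n (x y : X n) : composable i x y ->
  pcomp i x y = pcomp i (x : F n n) (y : F n n).
Proof.
move=> h; rewrite -(pcompE h) -(pcompE (proj1 (star_composable _ x y) h)).
by [].
Qed.

(** A cell of the n-th stage is a cell of its own dimension k of an earlier
stage; stripping the inclusions of stages one by one exhibits it as a k-cell
of the complex. *)
Fixpoint to_star_map n : forall k, F n k -> X k :=
  match n return forall k, F n k -> X k with
  | 0 => fun k => match k return F 0 k -> X k with
         | 0 => fun x => x
         | _.+1 => fun x => match x with end
         end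
  | m.+1 => fun k (x : ext_cell (stage_gen S m) k) =>
      match x in ext_cell _ k return X k with
      | old k c => to_star_map c
      | new q => new q
      end
  end.

Lemma to_star_id n (x : F n n) : to_star_map x = x :> X n.
Proof. by case: n x => //= n x; have [q ->] := ext_newP x. Qed.

Lemma to_star_src n k (x : F n k.+1) :
  to_star_map (src x) = src (to_star_map x).
Proof.
elim: n k x => [|n IH] k x; first by case: x.
case: (ext_case (x : ext_glob (stage_gen S n) k.+1)) => [le|[e]].
  by have [c ->] := ext_oldP le x; apply: IH.
subst k; have [q ->] := ext_newP (x : ext_glob (stage_gen S n) n.+1).
exact: to_star_id.
Qed.

Lemma to_star_tgt n k (x : F n k.+1) :
  to_star_map (tgt x) = tgt (to_star_map x).
Proof.
elim: n k x => [|n IH] k x; first by case: x.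
case: (ext_case (x : ext_glob (stage_gen S n) k.+1)) => [le|[e]].
  by have [c ->] := ext_oldP le x; apply: IH.
subst k; have [q ->] := ext_newP (x : ext_glob (stage_gen S n) n.+1).
exact: to_star_id.
Qed.

Lemma to_star_unit n k b b' (x : F n k) :
  to_star_map (cunit b x) = @cunit _ X k b' (to_star_map x).
Proof.
elim: n k b b' x => [|n IH] k b b' x //.
have := (b : is_true (k < n.+1)); rewrite ltnS leq_eqVlt => /orP[/eqP e|lt].
  subst k; have [c ->] := ext_oldP (leqnn n) (x : ext_glob (stage_gen S n) n).
  rewrite [@cunit _ (F n.+1) _ _ _](@cunit_class n (F n) (stage_gen S n)) /=.
  rewrite to_star_id; symmetry.
  exact: (@cunit_class n (F n) (stage_gen S n)).
have [c ->] := ext_oldP (ltnW lt) (x : ext_glob (stage_gen S n) k).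
rewrite [@cunit _ (F n.+1) _ _ _](@ext_unit_old n _ (stage_gen S n) _ _ lt).
exact: IH.
Qed.

Lemma to_star_comp n i k (x y : F n k) (h : composable i x y)
  (h' : composable i (to_star_map x : X k) (to_star_map y)) :
  to_star_map (comp h) = comp h'.
Proof.
elim: n k x y h h' => [|n IH] k x y h h'.
  by case: (discrete_composable h).
case: (ext_case (x : ext_glob (stage_gen S n) k)) => [le|e].
  have [c ex] := ext_oldP le (x : ext_glob (stage_gen S n) k).
  have [d ey] := ext_oldP le (y : ext_glob (stage_gen S n) k).
  subst x y; have k' := proj1 (composable_old _ _ _ _) h.
  rewrite [@comp _ (F n.+1) _ _ _ _ _](ext_comp_old h k').
  exact: IH.
subst k; rewrite [LHS](@to_star_id n.+1) (pcompE h') (star_pcomp h') (pcompE h).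
by rewrite !(@to_star_id n.+1).
Qed.

Definition to_star n : functor (F n) X :=
  Functor (@to_star_src n) (@to_star_tgt n) (@to_star_unit n) (@to_star_comp n).

End Star.

(** * Weights and occurrences in a free complex *)

Section StarCells.
Variable S : polygraph.
Local Notation X := (free_complex S).
Local Notation F := (free_ncat S).
Local Notation star_cunit c := (@cunit None X _ isT c).

Definition star_gen n (g : stage_gen S n) : X n.+1 := gen_cell g.

Definition star_weight n (phi : stage_gen S n -> nat) (x : X n.+1) : nat :=
  @weight n (F n) (stage_gen S n) phi x.

Lemma star_gen_src n (g : stage_gen S n) : src (star_gen g) = gsrc g.
Proof.
by apply: (@old_inj _ _ (stage_gen S n)); rewrite inc_src /= top_src_class.
Qed.

Lemma star_gen_tgt n (g : stage_gen S n) : tgt (star_gen g) = gtgt g.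
Proof.
by apply: (@old_inj _ _ (stage_gen S n)); rewrite inc_tgt /= top_tgt_class.
Qed.

Lemma star_ind n (P : X n.+1 -> Prop) :
  (forall g, P (star_gen g)) ->
  (forall (c : X n), P (star_cunit c)) ->
  (forall i (x y : X n.+1), composable i x y ->
     P x -> P y -> P (pcomp i x y)) ->
  forall x, P x.
Proof.
move=> Pg Pu Pc; apply: (@free_ind n (F n) (stage_gen S n)) => // [b c|i x y h].
  by rewrite (bool_irrelevance b (leqnn n.+1)); apply: (Pu c).
have h' := proj2 (@star_composable S i n.+1 x y) h.
by move=> Px Py; have := Pc i x y h' Px Py; rewrite (star_pcomp h').
Qed.

Lemma star_weight_gen n phi (g : stage_gen S n) :
  star_weight phi (star_gen g) = phi g.
Proof. exact: weight_gen. Qed.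

Lemma star_weight_unit n (phi : stage_gen S n -> nat) b (c : X n) :
  star_weight phi (cunit b c) = 0.
Proof. exact: weight_unit. Qed.

Lemma star_weight_pcomp n (phi : stage_gen S n -> nat) i (x y : X n.+1) :
  composable i x y ->
  star_weight phi (pcomp i x y) = star_weight phi x + star_weight phi y.
Proof.
move=> h; rewrite /star_weight (star_pcomp h).
by apply: weight_pcomp; apply/star_composable.
Qed.

(** The value in dimension 0 is a convention: there are no compositions of
0-cells. *)
Definition length n : X n -> nat :=
  match n with
  | 0 => fun _ => 0
  | m.+1 => fun x => star_weight (fun _ : stage_gen S m => 1) x
  end.

Lemma length_pcomp i n (x y : X n) : composable i x y ->
  length (pcomp i x y) = length x + length y.
Proof.
case: n x y => [|n] x y h; first by have := composable_lt h.
exact: star_weight_pcomp.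
Qed.

Lemma length0 n (x : X n.+1) b : length x = 0 -> x = cunit b (src x).
Proof.
move=> /(@weight0 n (F n) (stage_gen S n)) /(_ (leqnn n.+1)) [c ->].
have [d ->] := @ext_oldP _ _ (stage_gen S n) n (leqnn n) c.
have -> : @cunit _ (free_cat (stage_gen S n)) n (leqnn n.+1)
  (old (stage_gen S n) d) = @cunit _ X n b d by [].
by rewrite (src_unit (catP X)).
Qed.

Definition occurs n (g : stage_gen S n) (x : X n.+1) : Prop :=
  0 < star_weight (fun g' => `[< g' = g >]) x.

Lemma occurs_gen n (g g' : stage_gen S n) : occurs g (star_gen g') <-> g' = g.
Proof. by rewrite /occurs star_weight_gen lt0b; split=> /asboolP. Qed.

Lemma occurs_unit n (g : stage_gen S n) b (c : X n) : ~ occurs g (cunit b c).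
Proof. by rewrite /occurs star_weight_unit. Qed.

Lemma occurs_pcomp n (g : stage_gen S n) i (x y : X n.+1) : composable i x y ->
  occurs g (pcomp i x y) <-> occurs g x \/ occurs g y.
Proof.
by move=> h; rewrite /occurs star_weight_pcomp // addn_gt0; split=> [/orP|/orP].
Qed.

(** The weight is a sum over occurrences, and sums of pointwise ordered
families are equal only if all their terms are. *)
Lemma star_weight_le n (phi phi' : stage_gen S n -> nat) x :
  (forall g, phi g <= phi' g) ->
  star_weight phi x <= star_weight phi' x /\
  (star_weight phi x = star_weight phi' x ->
     forall g, occurs g x -> phi g = phi' g).
Proof.
move=> le; move: x; apply: star_ind => [g|c|i x y h [lx IHx] [ly IHy]].
- by rewrite !star_weight_gen; split=> // e g' /occurs_gen <-.
- by rewrite !star_weight_unit; split=> // _ g /occurs_unit.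
rewrite !star_weight_pcomp //; split; first exact: leq_add.
move=> e g; have ex : star_weight phi x = star_weight phi' x.
  apply/eqP; rewrite eqn_leq lx -(leq_add2r (star_weight phi' y)) -e.
  by rewrite leq_add2l.
have ey : star_weight phi y = star_weight phi' y.
  by apply: (@addnI (star_weight phi' x)); rewrite -e ex.
by case/(occurs_pcomp _ h); [apply: IHx | apply: IHy].
Qed.

Lemma star_weight_ge n (phi : stage_gen S n -> nat) g x : occurs g x ->
  phi g <= star_weight phi x.
Proof.
move: x; apply: star_ind => [g'|c|i x y h IHx IHy].
- by move=> /occurs_gen ->; rewrite star_weight_gen.
- by move=> /occurs_unit.
rewrite star_weight_pcomp // => /(occurs_pcomp _ h) [/IHx|/IHy] le.
  exact: leq_trans le (leq_addr _ _).
exact: leq_trans le (leq_addl _ _).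
Qed.

Lemma star_weight_ge2 n (phi : stage_gen S n -> nat) g g' x : g <> g' ->
  occurs g x -> occurs g' x -> phi g + phi g' <= star_weight phi x.
Proof.
move=> ne; move: x; apply: star_ind => [g0|c|i x y h IHx IHy].
- by move=> /occurs_gen e /occurs_gen e'; case: ne; rewrite -e.
- by move=> /occurs_unit.
rewrite star_weight_pcomp // => /(occurs_pcomp _ h) ox /(occurs_pcomp _ h) oy.
case: ox oy => [ox|ox] [oy|oy].
- exact: leq_trans (IHx ox oy) (leq_addr _ _).
- by apply: leq_add; apply: star_weight_ge.
- by rewrite addnC; apply: leq_add; apply: star_weight_ge.
- exact: leq_trans (IHy ox oy) (leq_addl _ _).
Qed.

Lemma star_ind_occurs n (x : X n.+1) (P : X n.+1 -> Prop) :
  (forall g, occurs g x -> P (star_gen g)) ->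
  (forall (c : X n), P (star_cunit c)) ->
  (forall i (x y : X n.+1), composable i x y ->
     P x -> P y -> P (pcomp i x y)) ->
  P x.
Proof.
move=> Pg Pu Pc.
suff : (forall g, occurs g x -> P (star_gen g)) -> P x by apply.
move: x {Pg}; apply: star_ind => [g Pg|c _|i x y h IHx IHy Pg].
- exact/Pg/occurs_gen.
- exact: Pu.
apply: (Pc _ _ _ h).
  by apply: IHx => g og; apply/Pg/(occurs_pcomp _ h); left.
by apply: IHy => g og; apply/Pg/(occurs_pcomp _ h); right.
Qed.

End StarCells.

(** * Persistent generators of an idempotent *)

Section Idempotent.
Variables (S : polygraph).
Local Notation X := (free_complex S).
Local Notation F := (free_ncat S).
Local Notation star_cunit c := (@cunit None X _ isT c).
Variables (h : functor X X).
Hypothesis hK : forall n (x : X n), h n (h n x) = h n x.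

Local Notation himage g := (h _ (star_gen g)).

Definition collapsed n (x : X n.+1) : Prop := exists c, h n.+1 x = star_cunit c.

Definition visible n (g : stage_gen S n) : nat :=
  ~~ `[< collapsed (star_gen g) >].

(** On visible generators, the row of [g] in the matrix of [h] is that of the
identity. *)
Definition persistent n (g : stage_gen S n) : Prop :=
  star_weight (@visible n) (himage g) = 1 /\ occurs g (himage g).

(** Both sides are additive in [x] and vanish on units: this is the matrix of
[h]. *)
Lemma star_weight_map n (phi : stage_gen S n -> nat) x :
  star_weight phi (h n.+1 x) =
  star_weight (fun g => star_weight phi (himage g)) x.
Proof.
move: x; apply: star_ind => [g|c|i x y hxy ex ey].
- by rewrite star_weight_gen.
- by rewrite (fmap_unit h _ isT) !star_weight_unit.
- rewrite fmap_pcomp // !star_weight_pcomp ?ex ?ey //.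
  exact: fmap_composable.
Qed.

Lemma occurs_map n (g : stage_gen S n) x : occurs g (h n.+1 x) ->
  exists2 g', occurs g' x & occurs g (himage g').
Proof.
move: x; apply: star_ind => [g'|c|i x y hxy IHx IHy].
- by exists g' => //; apply/occurs_gen.
- by rewrite (fmap_unit h _ isT) => /occurs_unit.
- rewrite fmap_pcomp //.
  by case/(occurs_pcomp _ (fmap_composable h hxy)) => [/IHx|/IHy] [g' o o'];
    exists g' => //; apply/(occurs_pcomp _ hxy); auto.
Qed.

(** Only collapsed generators occur in [x], so its image is a composite of
units. *)
Lemma visible_map0 n x : star_weight (@visible n) x = 0 -> collapsed x.
Proof.
move: x; apply: star_ind => [g|c|i x y hxy IHx IHy].
- by rewrite star_weight_gen /visible => /eqP; rewrite eqb0 negbK => /asboolP.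
- by exists (h n c); rewrite (fmap_unit h _ isT).
rewrite star_weight_pcomp // => /eqP; rewrite addn_eq0.
move=> /andP[/eqP/IHx [c ex] /eqP/IHy [d ey]].
have := fmap_composable h hxy; rewrite /collapsed fmap_pcomp // ex ey.
by move=> /pcomp_cunit [z ->]; exists z.
Qed.

Lemma visible_occurs n (g g' : stage_gen S n) : occurs g (himage g') ->
  visible g' = 1.
Proof.
move=> o; rewrite /visible; case: asboolP => // -[c e].
by move: o; rewrite e => /occurs_unit.
Qed.

(** If [himage g] contained collapsed generators only, then [h (himage g)]
would be a unit; but this is [himage g]. *)
Lemma visible_le n (g : stage_gen S n) :
  visible g <= star_weight (@visible n) (himage g).
Proof.
case e : (star_weight _ _) => [|k]; last exact: leq_trans (leq_b1 _) _.
have := visible_map0 e; rewrite /collapsed hK => c.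
by rewrite /visible; case: asboolP => // -[].
Qed.

(** For [x] fixed, the number of visible generators of [x] is also the number
of those of [h x], which is at least as large by [visible_le]; so each visible
generator of [x] has an image with a single visible generator.  It remains to
see that this generator is the same for [g]. *)
Lemma fixed_persistent n (x : X n.+1) (g : stage_gen S n) :
  h n.+1 x = x -> occurs g x -> collapsed (star_gen g) \/ persistent g.
Proof.
move=> hx og.
case: (pselect (collapsed (star_gen g))) => [|nc]; [by left | right].
have vg : visible g = 1 by rewrite /visible; case: asboolP.
have one g' : occurs g' x -> visible g' = 1 ->
    star_weight (@visible n) (himage g') = 1.
  move=> o v.
  have [_ E] := @star_weight_le _ _ (@visible n) _ x (@visible_le n).
  by rewrite -(E _ g' o) // -star_weight_map hx.
(* [g] occurs in [x = h x], hence in the image of some visible [g1] of [x], of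
   which it is the visible generator. *)
have [g1 o1 og1] : exists2 g', occurs g' x & occurs g (himage g').
  by apply: occurs_map; rewrite hx.
have v1 := visible_occurs og1; have w1 := one g1 o1 v1.
(* As [himage g1] is fixed, [g] also occurs in the image of some visible
   generator of [himage g1], which can only be [g]. *)
have [g2 o2 og2] : exists2 g', occurs g' (himage g1) & occurs g (himage g').
  by apply: occurs_map; rewrite hK.
have v2 := visible_occurs og2.
have e : g2 = g.
  apply: contrapT => ne; have := star_weight_ge2 (@visible n) ne o2 og1.
  by rewrite w1 v2 vg.
by rewrite e in og2; split; [apply: one | apply: og2].
Qed.

(** [g] and [g'] are both visible, and the image of [g] has room for one
visible generator only. *)
Lemma persistent_eq n (g g' : stage_gen S n) : persistent g -> persistent g' ->
  occurs g' (himage g) -> g' = g.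
Proof.
move=> [w o] [_ o'] og; apply: contrapT => ne.
have := star_weight_ge2 (@visible n) ne og o.
by rewrite w (visible_occurs o) (visible_occurs o').
Qed.

(** * A free basis of the fixed cells, one dimension at a time *)

(** An n-category isomorphic to the subcomplex of fixed cells, up to dimension
n. *)
Record state n (C : ncat n) := State {
  st_fun :> functor C X;
  st_inj : forall k, injective (st_fun k);
  st_fix : forall k (c : C k), h k (st_fun k c) = st_fun k c;
  st_img : forall k (x : X k), k <= n -> h k x = x -> exists c, st_fun k c = x
}.

Section Step.
Variables (n : nat) (C : ncat n) (st : state C).

Lemma lift_ex k (le : k <= n) (x : X k) : exists c, st k c = h k x.
Proof. exact: st_img. Qed.

Definition lift k (le : k <= n) (x : X k) : C k := sval (cid (lift_ex le x)).

Lemma liftK k (le : k <= n) (x : X k) : st k (lift le x) = h k x.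
Proof. exact: (svalP (cid (lift_ex le x))). Qed.

Lemma reflect_parallel k (c d : C k) :
  parallel (st k c) (st k d) -> parallel c d.
Proof.
case: k c d => [//|k] c d [es et].
split; apply: (@st_inj _ _ st); first by rewrite !fmap_src; apply: es.
by rewrite !fmap_tgt; apply: et.
Qed.

Lemma lift_par (g : stage_gen S n) :
  parallel (lift (leqnn n) (gsrc g)) (lift (leqnn n) (gtgt g)).
Proof.
apply: reflect_parallel; rewrite !liftK -star_gen_src -star_gen_tgt.
by rewrite fmap_src fmap_tgt; apply: parallel_bd.
Qed.

Definition step_gen : generators C :=
  @Generators n C {g : stage_gen S n | persistent g}
    (fun g => lift (leqnn n) (gsrc (sval g)))
    (fun g => lift (leqnn n) (gtgt (sval g))) (fun g => lift_par (sval g)).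

Local Notation E := (free_cat step_gen).

Definition step_val (g : step_gen) : X n.+1 := himage (sval g).

Lemma step_val_src g : src (step_val g) = st n (gsrc g).
Proof. by rewrite liftK -fmap_src star_gen_src. Qed.

Lemma step_val_tgt g : tgt (step_val g) = st n (gtgt g).
Proof. by rewrite liftK -fmap_tgt star_gen_tgt. Qed.

Definition step_fun : functor E X :=
  @extend _ _ _ None X isT _ _ step_val_src step_val_tgt.

Lemma step_fun_old k (c : C k) : step_fun k (incl step_gen c) = st k c.
Proof. by []. Qed.

Lemma step_fun_gen g : step_fun n.+1 (gen_cell g) = step_val g.
Proof. exact: extend_gen. Qed.

Lemma step_inj_low k : k <= n -> injective (step_fun k).
Proof.
move=> le x y; have [c ->] := ext_oldP le x; have [d ->] := ext_oldP le y.
by move=> /(@st_inj _ _ st) ->.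
Qed.

Lemma step_reflect i (x y : E n.+1) :
  composable i (step_fun n.+1 x) (step_fun n.+1 y) -> composable i x y.
Proof.
move=> hc; have := composable_lt hc; rewrite ltnS => /step_inj_low inj.
exact: (reflect_composable (fmap_src step_fun) (fmap_tgt step_fun) inj hc).
Qed.

Lemma step_fix k (x : E k) : h k (step_fun k x) = step_fun k x.
Proof.
case: (ext_case x) => [le|e].
  by have [c ->] := ext_oldP le x; apply: st_fix.
subst k; move: x; apply: free_ind => [g|b c|i x y hxy ex ey].
- by rewrite step_fun_gen hK.
- rewrite (fmap_unit step_fun _ isT) (fmap_unit h _ isT).
  by congr cunit; apply: st_fix.
- by rewrite !fmap_pcomp ?ex ?ey //; apply: fmap_composable.
Qed.

Lemma step_unit (c : X n) : h n c = c ->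
  exists e, step_fun n.+1 e = star_cunit c.
Proof.
move=> hc; have [d e] := st_img st (leqnn n) hc.
exists (@cunit _ E n (leqnn n.+1) (incl step_gen d)).
by rewrite (fmap_unit step_fun _ isT) step_fun_old e.
Qed.

(** The generators occurring in [x = h x] are collapsed or persistent, and [h]
maps both kinds, hence [x], into the image of [step_fun]. *)
Lemma step_img_top (x : X n.+1) : h n.+1 x = x ->
  exists e, step_fun n.+1 e = x.
Proof.
move=> hx; pose P (y : X n.+1) := exists e, step_fun n.+1 e = h n.+1 y.
suff [e ee] : P x by exists e; rewrite ee.
apply: star_ind_occurs => [g og|c|i y z hyz [e ee] [e' ee']]; rewrite /P.
- case: (fixed_persistent hx og) => [[c ec]|s1].
    rewrite ec; apply: step_unit.
    have <- : src (star_cunit c : X n.+1) = c by rewrite (src_unit (catP X)).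
    by rewrite -ec fmap_src hK.
  by exists (gen_cell (exist _ g s1 : step_gen)); rewrite step_fun_gen.
- by rewrite (fmap_unit h _ isT); apply: step_unit.
- have hc := fmap_composable h hyz.
  exists (pcomp i e e'); rewrite fmap_pcomp ?fmap_pcomp ?ee ?ee' //.
  by apply: step_reflect; rewrite ee ee'.
Qed.

Lemma step_img k (x : X k) : k <= n.+1 -> h k x = x ->
  exists e, step_fun k e = x.
Proof.
rewrite leq_eqVlt => /orP[/eqP e|le] hx; first by subst k; apply: step_img_top.
by have [c <-] := st_img st le hx; exists (incl step_gen c).
Qed.

(** Below dimension n+1, the retraction is [h] followed by the inverse of
[st]. *)
Definition back_map k (x : F n k) : E k :=
  incl step_gen (lift (cell_dim x) (to_star S n k x)).

Lemma back_mapK k (x : F n k) : step_fun k (back_map x) = h k (to_star S n k x).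
Proof. exact: liftK. Qed.

Lemma stage_dim k (x : F n k) : k <= n. Proof. exact: (cell_dim x). Qed.

Definition back : functor (F n) E.
Proof.
exists back_map.
- move=> k x; apply: step_inj_low; first exact: ltnW (stage_dim x).
  by rewrite fmap_src !back_mapK !fmap_src.
- move=> k x; apply: step_inj_low; first exact: ltnW (stage_dim x).
  by rewrite fmap_tgt !back_mapK !fmap_tgt.
- move=> k b b' x; apply: step_inj_low; first exact: b.
  rewrite (fmap_unit step_fun _ isT) !back_mapK.
  by rewrite (fmap_unit (to_star S n) _ isT) (fmap_unit h _ isT).
- move=> i k x y hxy hxy'; apply: step_inj_low; first exact: (stage_dim x).
  rewrite !pcompE fmap_pcomp // !back_mapK !fmap_pcomp //.
  exact: fmap_composable.
Defined.

(** Any preimage will do: the choice is immaterial once [step_fun] is known to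
be injective. *)
Definition ret_val (g : stage_gen S n) : E n.+1 :=
  sval (cid (step_img_top (hK (star_gen g)))).

Lemma ret_valK g : step_fun n.+1 (ret_val g) = himage g.
Proof. exact: (svalP (cid (step_img_top (hK (star_gen g))))). Qed.

Lemma ret_val_src g : src (ret_val g) = back n (gsrc g).
Proof.
apply: step_inj_low => //.
rewrite fmap_src ret_valK [RHS]back_mapK -fmap_src star_gen_src.
by rewrite [to_star _ _ _ _]to_star_id.
Qed.

Lemma ret_val_tgt g : tgt (ret_val g) = back n (gtgt g).
Proof.
apply: step_inj_low => //.
rewrite fmap_tgt ret_valK [RHS]back_mapK -fmap_tgt star_gen_tgt.
by rewrite [to_star _ _ _ _]to_star_id.
Qed.

Definition ret : functor (free_cat (stage_gen S n)) E :=
  @extend _ _ _ (Some n.+1) E (leqnn n.+1) _ _ ret_val_src ret_val_tgt.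

(** (n+1)-cells of the complex and of its (n+1)-st stage are the same. *)
Definition star_ret (x : X n.+1) : E n.+1 := ret n.+1 x.

Lemma star_ret_gen g : star_ret (star_gen g) = ret_val g.
Proof. exact: extend_gen. Qed.

Lemma star_ret_pcomp i (x y : X n.+1) : composable i x y ->
  composable i (star_ret x) (star_ret y) /\
  star_ret (pcomp i x y) = pcomp i (star_ret x) (star_ret y).
Proof.
move=> hxy; have hxy' := proj1 (@star_composable S i n.+1 x y) hxy.
split; first exact: (fmap_composable ret hxy').
rewrite (star_pcomp hxy); exact: (fmap_pcomp ret hxy').
Qed.

Lemma star_ret_unit b b' (c : X n) : 
  star_ret (cunit b c) = cunit b' (back n c).
Proof. exact: (fmap_unit ret). Qed.

Lemma step_star_ret (x : X n.+1) : step_fun n.+1 (star_ret x) = h n.+1 x.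
Proof.
move: x; apply: star_ind => [g|c|i x y hxy ex ey].
- by rewrite star_ret_gen ret_valK.
- rewrite (star_ret_unit _ (leqnn n.+1)).
  rewrite (fmap_unit step_fun _ isT) (fmap_unit h _ isT).
  by rewrite [step_fun _ _]back_mapK [to_star _ _ _ _]to_star_id.
- have [hc ->] := star_ret_pcomp hxy.
  by rewrite !fmap_pcomp ?ex ?ey.
Qed.

Lemma weight_step (phi : stage_gen S n -> nat) (x : E n.+1) :
  star_weight phi (step_fun n.+1 x) =
  weight (fun g => star_weight phi (step_val g)) x.
Proof.
move: x; apply: free_ind => [g|b c|i x y hxy ex ey].
- by rewrite step_fun_gen weight_gen.
- by rewrite (fmap_unit step_fun _ isT) star_weight_unit weight_unit.
- rewrite fmap_pcomp // star_weight_pcomp ?weight_pcomp ?ex ?ey //.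
  exact: fmap_composable.
Qed.

Lemma context_occurs (g : step_gen) k (x : E n.+1) : context (gen_cell g) k x ->
  occurs (sval g) (step_fun n.+1 x).
Proof.
elim=> {x} [|i b y _ _ hby _ IH|i b y _ _ hby _ IH].
- by rewrite step_fun_gen; apply: (svalP g).2.
- rewrite fmap_pcomp //.
  by apply/(occurs_pcomp _ (fmap_composable _ hby)); right.
- rewrite fmap_pcomp //.
  by apply/(occurs_pcomp _ (fmap_composable _ hby)); left.
Qed.

(** The length of sources in [X] detects degeneracy in [E] because [step_fun]
is injective in dimensions at most n. *)
Lemma step_detects k (lt : k < n.+1) :
  k < n -> detects k (fun x => length (src_to lt (step_fun n.+1 x))).
Proof.
move=> ltn; split=> [i x y le hxy|b db].
  have hs := fmap_composable step_fun hxy.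
  rewrite fmap_pcomp // src_to_pcomp // length_pcomp //.
  exact: composable_src_to.
move=> /(length0 (leqnn 0)) e.
have b' : within (Some n.+1) k.+1 := ltnW ltn.
apply: (degenerateS (lt := lt) (b := b') db).
apply: step_inj_low => //.
by rewrite (fmap_unit step_fun _ isT) fmap_src fmap_src_to.
Qed.

(** [y] has weight one since its image does, its generator is [g] since it
occurs in the image of [g], and the context of [g] in [y] is trivial since
lengths of sources are computed in [X]. *)
Lemma step_fun_gen_inj (g : step_gen) (y : E n.+1) :
  step_fun n.+1 y = step_val g -> y = gen_cell g.
Proof.
move=> ey; have w1 : weight (fun _ : step_gen => 1) y = 1.
  transitivity (star_weight (@visible n) (step_fun n.+1 y)).
    rewrite weight_step; congr weight; apply/funext => g'.
    by rewrite (svalP g').1.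
  by rewrite ey; apply: (svalP g).1.
have [g' cg'] := weight1 w1.
have eg : g' = g.
  have := context_occurs cg'; rewrite ey.
  move=> /(persistent_eq (svalP g) (svalP g')).
  by case: (g) (g') => [g0 s0] [g1 s1] /= e; subst g1;
    rewrite (Prop_irrelevance s0 s1).
subst g'; apply: (context_trivial cg') => j lt.
have lt' : j < n.+1 := leqW lt.
eexists; first exact: (step_detects lt' lt).
exact: (congr1 (fun z => length (src_to lt' z))
          (etrans ey (esym (step_fun_gen g)))).
Qed.

Lemma ret_step (x : E n.+1) : star_ret (step_fun n.+1 x) = x.
Proof.
move: x; apply: free_ind => [g|b c|i x y hxy ex ey].
- by apply: step_fun_gen_inj; rewrite step_fun_gen step_star_ret hK.
- rewrite (fmap_unit step_fun _ isT) (star_ret_unit _ b); congr cunit.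
  apply: step_inj_low => //.
  by rewrite [LHS]back_mapK [to_star _ _ _ _]to_star_id step_fix.
- have hs := fmap_composable step_fun hxy.
  by rewrite fmap_pcomp // (star_ret_pcomp hs).2 ex ey.
Qed.

Lemma step_inj k : injective (step_fun k).
Proof.
move=> x y; case: (ext_case x) => [le|e]; first exact: step_inj_low.
by subst k => e; rewrite -(ret_step x) e ret_step.
Qed.

Definition step_state : state E := State step_inj step_fix step_img.

End Step.

(** * The splitting *)

CoFixpoint build n (C : ncat n) (st : state C) : tower C :=
  Tower (build (step_state st)).

Definition start_map k : discrete {x : X 0 | h 0 x = x} k -> X k :=
  match k with
  | 0 => fun x => sval x
  | _.+1 => fun x => match x with end
  end.

Definition start_fun : functor (discrete {x : X 0 | h 0 x = x}) X.
Proof.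
exists start_map => [k []|k []|//|i k x y hxy] //.
by case: (discrete_composable hxy).
Defined.

Definition start : state (discrete {x : X 0 | h 0 x = x}).
Proof.
exists start_fun.
- case=> [|k] x y; last by case: x.
  case: x y => [x hx] [y hy] /= e; subst y.
  by rewrite (Prop_irrelevance hx hy).
- by case=> [|k] [].
- by case=> // x _ hx; exists (exist (fun x : X 0 => h 0 x = x) x hx).
Defined.

Definition splitting : polygraph := Polygraph (build start).
Local Notation T := splitting.
Local Notation Y := (free_complex T).

Definition tracked n : Type :=
  {st : state (free_ncat T n) | projT2 (stage T n) = build st}.

(** Stated for an arbitrary tower equal to a [build], so that no transport
along an equality of stages is needed. *)
Lemma track_step n (C : ncat n) (tw : tower C) (st : state C) : tw = build st ->
  {st' : state (free_cat (tower_gen tw)) |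
    tower_next tw = build st' /\
    forall k (c : C k), st' k (old (tower_gen tw) c) = st k c}.
Proof. by move=> ->; exists (step_state st). Qed.

Fixpoint track n : tracked n :=
  match n with
  | 0 => exist _ start erefl
  | m.+1 => let: exist st' p := track_step (svalP (track m)) in
            exist _ st' p.1
  end.

Definition embed n (x : Y n) : X n := sval (track n) n x.

Lemma track_old n k (c : free_ncat T n k) :
  sval (track n.+1) k (old (stage_gen T n) c) = sval (track n) k c.
Proof. by rewrite /=; case: track_step => st' [e E] /=; apply: E. Qed.

Lemma embed_src n (x : Y n.+1) : embed (src x) = src (embed x).
Proof.
rewrite /embed -track_old.
rewrite (_ : old _ _ = src (x : free_ncat T n.+1 n.+1)); first exact: fmap_src.
exact: inc_src.
Qed.

Lemma embed_tgt n (x : Y n.+1) : embed (tgt x) = tgt (embed x).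
Proof.
rewrite /embed -track_old.
rewrite (_ : old _ _ = tgt (x : free_ncat T n.+1 n.+1)); first exact: fmap_tgt.
exact: inc_tgt.
Qed.

Lemma embed_unit n b (x : Y n) : embed (cunit b x) = cunit b (embed x).
Proof.
rewrite /embed -(track_old (x : free_ncat T n n)).
exact: (fmap_unit (sval (track n.+1))).
Qed.

Lemma embed_comp i n (x y : Y n) (hxy : composable i x y)
  (h' : composable i (embed x) (embed y)) : embed (comp hxy) = comp h'.
Proof.
rewrite (pcompE h'); set k := proj1 (star_composable i x y) hxy.
exact: (etrans (congr1 (sval (track n) n) (pcompE k))
          (fmap_pcomp (sval (track n)) k)).
Qed.

Lemma embed_inj n : injective (@embed n).
Proof. exact: st_inj. Qed.

Lemma embed_fix n (x : Y n) : h n (embed x) = embed x.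
Proof. exact: st_fix. Qed.

(** [h x] is fixed, hence in the image of the state of dimension n. *)
Lemma embed_img n (x : X n) : exists y, @embed n y = h n x.
Proof. by apply: (st_img (sval (track n))). Qed.

Definition embedding : cat_hom Y X :=
  CatHom embed_src embed_tgt embed_unit embed_comp.

Definition project n (x : X n) : Y n := sval (cid (embed_img x)).

Lemma projectK n (x : X n) : embed (project x) = h n x.
Proof. exact: (svalP (cid (embed_img x))). Qed.

Definition projection : cat_hom X Y.
Proof.
exists project.
- by move=> n x; apply: embed_inj; rewrite embed_src !projectK fmap_src.
- by move=> n x; apply: embed_inj; rewrite embed_tgt !projectK fmap_tgt.
- move=> n b x; apply: embed_inj; rewrite embed_unit !projectK.
  exact: fmap_unit.
- move=> i n x y hxy hxy'; apply: embed_inj.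
  have e := map_composable embed_src embed_tgt hxy'.
  by rewrite (embed_comp _ e) !pcompE !projectK fmap_pcomp.
Defined.

End Idempotent.

Definition functor_of_hom N (C D : cat N) (f : cat_hom C D) : functor C D.
Proof.
exists f => [n x|n x|n b b' x|i n x y h h'].
- exact: cmap_src.
- exact: cmap_tgt.
- by rewrite (bool_irrelevance b' b); apply: cmap_unit.
- exact: cmap_comp.
Defined.

Theorem theorem2 : Cauchy_complete Fcompl.
Proof.
move=> [C [S eC]]; subst C => /= h hh.
have hK n (x : free_complex S n) :
    functor_of_hom h n (functor_of_hom h n x) = functor_of_hom h n x.
  exact: (congr1 (fun f : cat_hom _ _ => f n x) hh).
exists (exist _ (free_complex (splitting hK)) (ex_intro _ _ erefl)).
exists (projection hK), (embedding hK); split; apply: cat_hom_eq => n x /=.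
  exact: projectK.
by apply: (@embed_inj _ _ hK); rewrite projectK; apply: embed_fix.
Qed.
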